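(* Let $r>0$, let $P^2\subset P^3\subset\mathbb{E}_1^4$ be linear subspaces of dimensions $2$ and $3$ with $P^3\cap\mathbb{H}^3(r)\neq\emptyset$, and let $\gamma:I\to \mathbb{H}^2(r)=P^3\cap\mathbb{H}^3(r)$ be a smooth regular curve, defined on an interval $I$, that does not intersect $P^2$. Suppose that the surface of revolution in $\mathbb{H}^3(r)$ generated by $\gamma$ and rotated around $P^2$ is minimal (its mean curvature in $\mathbb{H}^3(r)$ vanishes identically). Then $\gamma$ is an extrinsic catenary with respect to $P^2$. More explicitly: (1) if the surface of revolution is of elliptic type, then $\gamma$ is an extrinsic catenary of elliptic type; (2) if the surface of revolution is of hyperbolic type, then $\gamma$ is an extrinsic catenary of hyperbolic type; (3) if the surface of revolution is of parabolic type, then $\gamma$ is an extrinsic catenary of parabolic type.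
   Context: $\mathbb{E}_1^4$ is $\mathbb{R}^4$ with coordinates $(x,y,z,w)$ and the Lorentzian inner product $\langle X,Y\rangle_1=-X_0Y_0+X_1Y_1+X_2Y_2+X_3Y_3$. The hyperbolic space is $\mathbb{H}^3(r)=\{X\in\mathbb{E}_1^4:\langle X,X\rangle_1=-r^2,\ X_0>0\}$ with the induced Riemannian metric. If a 3-dimensional linear subspace $P^3$ meets $\mathbb{H}^3(r)$, then $P^3\cap\mathbb{H}^3(r)$ is a totally geodesic copy of the hyperbolic plane $\mathbb{H}^2(r)$. A subspace of $\mathbb{E}_1^4$ is Lorentzian, Riemannian, or degenerate if the restriction of $\langle\cdot,\cdot\rangle_1$ to it is a Lorentzian, Riemannian, or degenerate metric, respectively. $O(P^2)$ denotes the group of orthogonal transformations of $\mathbb{E}_1^4$ with positive determinant that leave $P^2$ pointwise fixed and map $\mathbb{H}^3(r)$ to itself. The surface of revolution generated by $\gamma$ and rotated around $P^2$ is the union of the orbits of the points of $\gamma$ under $O(P^2)$. It is of elliptic type if $P^2$ is Lorentzian, of hyperbolic type if $P^2$ is Riemannian, and of parabolic type if $P^2$ is degenerate. Extrinsic catenaries. Let $\nu\in P^3$ be a nonzero vector with $\langle\nu,p\rangle_1=0$ for all $p\in P^2$ (unique up to scaling). The extrinsic distance from $q\in P^3\cap\mathbb{H}^3(r)$ to $P^2$ is, up to a positive multiplicative constant (irrelevant for critical points), $\mathrm{dist}(q,P^2)=|\langle q,\nu\rangle_1|$. For $P^3=\{w=0\}$ and $q=(x,y,z,0)$ this gives $|z|$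 when $P^2=\mathrm{span}\{\mathbf{e}_x,\mathbf{e}_y\}$ (Lorentzian), $x$ when $P^2=\mathrm{span}\{\mathbf{e}_y,\mathbf{e}_z\}$ (Riemannian), and, up to a constant, $x-y$ when $P^2=\mathrm{span}\{\mathbf{e}_x+\mathbf{e}_y,\mathbf{e}_z\}$ (degenerate). A smooth regular curve $\gamma$ in $P^3\cap\mathbb{H}^3(r)$ not meeting $P^2$ is an extrinsic catenary with respect to $P^2$ if, on every compact subinterval $[a,b]$ of its domain, it is a critical point, among smooth variations in $P^3\cap\mathbb{H}^3(r)$ with fixed endpoints, of $$\mathcal{W}[\gamma]=\int_a^b \mathrm{dist}(\gamma(t),P^2)\,\|\dot\gamma(t)\|\,dt .$$ It is of elliptic, hyperbolic, or parabolic type if $P^2$ is Lorentzian, Riemannian, or degenerate, respectively. *)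

(* Defs.v *)
From HB Require Import structures.
From mathcomp Require Import all_boot all_order all_algebra.
From mathcomp Require Import all_classical all_reals all_analysis.

Set Implicit Arguments.
Unset Strict Implicit.
Unset Printing Implicit Defensive.

Import Order.TTheory GRing.Theory Num.Theory.
Import numFieldNormedType.Exports.

Local Open Scope classical_set_scope.
Local Open Scope ring_scope.

(* C^oo on an arbitrary subset A, in the sense of having a C^oo extension to an
   open neighborhood of A: functions being total, the values of f off A are
   taken to be those of the extension.  On an open set, having Frechet
   differentiable iterated directional derivatives of all orders is C^oo. *)
Definition smooth_on (R : realType) (V W : normedModType R)
    (A : set V) (f : V -> W) : Prop :=
  exists2 U : set V, open U /\ A `<=` U &
    forall (vs : seq V) (x : V), U x ->
      differentiable (foldr (fun v g => 'D_v g) f vs) x.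

Section LorentzSpace.
Variable R : realType.
Implicit Types (u v q : 'rV[R]_4) (P W : {vspace 'rV[R]_4}).

Definition lorentz u v : R :=
  - (u 0 ord0 * v 0 ord0)
  + \sum_(i < 3) u 0 (lift ord0 i) * v 0 (lift ord0 i).

Definition hyperbolic_space (r : R) : set 'rV[R]_4 :=
  [set q | lorentz q q = - r ^+ 2 /\ 0 < q 0 ord0].

Definition nondegenerate_subspace P : Prop :=
  forall u, u \in P -> (forall v, v \in P -> lorentz u v = 0) -> u = 0.

Definition negative_definite W : Prop :=
  forall u, u \in W -> u != 0 -> lorentz u u < 0.

(* Nondegenerate of index 1, the index being the largest dimension of a
   negative definite subspace. *)
Definition lorentzian P : Prop :=
  [/\ nondegenerate_subspace P,
      exists W, [/\ (W <= P)%VS, \dim W = 1%N & negative_definite W] &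
      forall W, (W <= P)%VS -> negative_definite W -> (\dim W <= 1)%N].

Definition riemannian P : Prop :=
  forall u, u \in P -> u != 0 -> 0 < lorentz u u.

Definition degenerate P : Prop := ~ nondegenerate_subspace P.

Variant revolution_type := Elliptic | Hyperbolic | Parabolic.

Definition is_of_type (k : revolution_type) P : Prop :=
  match k with
  | Elliptic => lorentzian P
  | Hyperbolic => riemannian P
  | Parabolic => degenerate P
  end.

(* Matrices act on row vectors from the right. *)
Definition revolution_group (r : R) P : set 'M[R]_4 :=
  [set A | [/\ forall u v, lorentz (u *m A) (v *m A) = lorentz u v,
               0 < \det A,
               forall p, p \in P -> p *m A = p &
               forall q, hyperbolic_space r q ->
                         hyperbolic_space r (q *m A)]].

Definition surface_of_revolution (r : R) P (I : set R)
    (gamma : R -> 'rV[R]_4) : set 'rV[R]_4 :=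
  [set q | exists t A,
     [/\ I t, revolution_group r P A & q = gamma t *m A]].

Definition surface_of_revolution_type (k : revolution_type) P : Prop :=
  is_of_type k P.

Definition immersed_patch (r : R) (U : set (R * R)%type)
    (X : R * R -> 'rV[R]_4) : Prop :=
  [/\ open U, smooth_on U X,
      forall p, U p -> hyperbolic_space r (X p) &
      forall p, U p -> free [:: 'D_(1, 0) X p; 'D_(0, 1) X p]].

Definition unit_normal (X : R * R -> 'rV[R]_4) (p : R * R)
    (N : 'rV[R]_4) : Prop :=
  [/\ lorentz N (X p) = 0, lorentz N ('D_(1, 0) X p) = 0,
      lorentz N ('D_(0, 1) X p) = 0 & lorentz N N = 1].

(* Orthogonal projection onto the tangent space of hyperbolic_space r at q; the
   Levi-Civita connection of hyperbolic_space r is the tangential part of the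
   flat one. *)
Definition tangent_part (r : R) q v : 'rV[R]_4 :=
  v + (lorentz v q / r ^+ 2) *: q.

Definition second_form (r : R) (X : R * R -> 'rV[R]_4) (p : R * R)
    (N : 'rV[R]_4) (a b : R * R) : R :=
  lorentz (tangent_part r (X p) ('D_a ('D_b X) p)) N.

Definition mean_curvature (r : R) (X : R * R -> 'rV[R]_4) (p : R * R)
    (N : 'rV[R]_4) : R :=
  let Xu := 'D_(1, 0) X p in
  let Xv := 'D_(0, 1) X p in
  let E := lorentz Xu Xu in
  let F := lorentz Xu Xv in
  let G := lorentz Xv Xv in
  let e := second_form r X p N (1, 0) (1, 0) in
  let f := second_form r X p N (1, 0) (0, 1) in
  let g := second_form r X p N (0, 1) (0, 1) in
  (e * G - 2 * f * F + g * E) / (2 * (E * G - F ^+ 2)).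

(* S may be merely immersed (the profile curve may cross itself), so minimality
   is tested on all immersed patches contained in S. *)
Definition minimal_surface (r : R) (S : set 'rV[R]_4) : Prop :=
  forall (U : set (R * R)%type) (X : R * R -> 'rV[R]_4),
    immersed_patch r U X -> X @` U `<=` S ->
    forall p N, U p -> unit_normal X p N -> mean_curvature r X p N = 0.

Definition hyperbolic_plane (r : R) P3 : set 'rV[R]_4 :=
  [set q | q \in P3 /\ hyperbolic_space r q].

Definition regular_curve (r : R) P3 (I : set R)
    (gamma : R -> 'rV[R]_4) : Prop :=
  [/\ smooth_on I gamma,
      forall t, I t -> hyperbolic_plane r P3 (gamma t) &
      forall t, I t -> 'D_1 gamma t != 0].

Definition avoids (I : set R) (gamma : R -> 'rV[R]_4) P2 : Prop :=
  forall t, I t -> gamma t \notin P2.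

Definition conormal P2 P3 (nu : 'rV[R]_4) : Prop :=
  [/\ nu \in P3, nu != 0 & forall p, p \in P2 -> lorentz nu p = 0].

Definition extrinsic_dist (nu q : 'rV[R]_4) : R := `|lorentz q nu|.

Definition catenary_functional (nu : 'rV[R]_4) (a b : R)
    (c : R -> 'rV[R]_4) : R :=
  \int[lebesgue_measure]_(t in `[a, b])
    (extrinsic_dist nu (c t) * Num.sqrt (lorentz ('D_1 c t) ('D_1 c t))).

Definition fixed_ends_variation (r : R) P3 (a b : R)
    (gamma : R -> 'rV[R]_4) (eps : R) (Gamma : R * R -> 'rV[R]_4) : Prop :=
  [/\ 0 < eps,
      smooth_on (`]- eps, eps[ `*` `[a, b]) Gamma,
      forall s t : R, s \in `]- eps, eps[ -> t \in `[a, b] ->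
        hyperbolic_plane r P3 (Gamma (s, t)),
      forall t : R, t \in `[a, b] -> Gamma (0, t) = gamma t &
      forall s : R, s \in `]- eps, eps[ ->
        Gamma (s, a) = gamma a /\ Gamma (s, b) = gamma b].

Definition critical_point (r : R) P3 (nu : 'rV[R]_4) (a b : R)
    (gamma : R -> 'rV[R]_4) : Prop :=
  forall eps Gamma, fixed_ends_variation r P3 a b gamma eps Gamma ->
    is_derive (0 : R) (1 : R)
      (fun s => catenary_functional nu a b (fun t => Gamma (s, t))) 0.

(* The conormal nu is unique up to a nonzero factor, which only rescales the
   functional, so quantifying over all of them is harmless. *)
Definition extrinsic_catenary (r : R) P2 P3 (I : set R)
    (gamma : R -> 'rV[R]_4) : Prop :=
  [/\ regular_curve r P3 I gamma, avoids I gamma P2 &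
      forall nu, conormal P2 P3 nu ->
      forall a b, a < b -> `[a, b] `<=` I ->
        critical_point r P3 nu a b gamma].

Definition extrinsic_catenary_of_type (k : revolution_type) (r : R) P2 P3
    (I : set R) (gamma : R -> 'rV[R]_4) : Prop :=
  extrinsic_catenary r P2 P3 I gamma /\ is_of_type k P2.

End LorentzSpace.

(* Main.v *)
(* Let [e] be a unit normal of P3 and [nu] a conormal of P2 in P3. The rotations
   around P2 are generated by J q = <q, nu> e - <q, e> nu, and since
   J^3 = - <nu, nu> J their Cayley parametrization is polynomial in J with
   rational coefficients, uniformly in the causal type of P2. Rotating gamma
   gives a patch X (s, y) with F = 0 on which the first and second fundamental
   forms at y = 0 are explicit; with h = <gamma, nu> and N the unit normal of
   gamma in P3, vanishing mean curvature becomes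
     h <gamma'', N> = <nu, N> |gamma'|^2.
   This is the Euler-Lagrange equation of the integral of |h| |gamma'|: for a
   variation field W, tangent to the hyperbolic plane and hence a combination of
   gamma' and N, the variation of the integrand is the derivative of
   <W, |h| gamma' / |gamma'|>, which vanishes at both ends. *)

Require Import Defs.
From HB Require Import structures.
From mathcomp Require Import all_boot all_order all_algebra.
From mathcomp Require Import all_classical all_reals all_analysis.
From mathcomp Require Import ring lra.

Set Implicit Arguments.
Unset Strict Implicit.
Unset Printing Implicit Defensive.

Import Order.TTheory GRing.Theory Num.Theory.
Import numFieldNormedType.Exports.

Local Open Scope classical_set_scope.
Local Open Scope ring_scope.

(** * The Lorentzian inner product and its rotations *)

Section LorentzAlgebra.
Variable R : realType.
Implicit Types (u v w p q : 'rV[R]_4) (a : R).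

(** Two facts tie the hypotheses to the calculus. A curve that avoids [P2] has [<gamma, nu>] nowhere
    zero; together with regularity this makes the rotated patch an immersion and keeps the integrand
    [|h| |gamma'|] differentiable. And minimality enters only through the mean curvature along
    [y = 0], so rotations close to the identity are enough and the poles of the Cayley coefficients
    do no harm; being rational, these coefficients are smooth by closure under sums, products and
    inverses. The delicate point is the end of an interval. Smoothness on [[a, b]] refers to an
    extension that may leave the hyperbolic plane outside [[a, b]], while patches need an open
    parameter domain. Hence the profile equation is established on the open interval only, which is
    what the fundamental theorem of calculus asks for, and tangency at [a] and [b] is read off from
    one-sided difference quotients. *)

Lemma lorentzE u v :
  lorentz u v = - (u 0 0 * v 0 0) + u 0 1 * v 0 1 + u 0 2%:R * v 0 2%:R
                + u 0 3%:R * v 0 3%:R.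
Proof.
rewrite /lorentz !big_ord_recl big_ord0 addr0 !addrA.
by do !congr (_ + _); congr (_ * _); congr (_ _ _); apply/val_inj.
Qed.

Lemma lorentzC u v : lorentz u v = lorentz v u.
Proof. by rewrite !lorentzE; ring. Qed.

Lemma lorentzDl u v w : lorentz (u + v) w = lorentz u w + lorentz v w.
Proof. by rewrite !lorentzE !mxE; ring. Qed.

Lemma lorentzZl a u v : lorentz (a *: u) v = a * lorentz u v.
Proof. by rewrite !lorentzE !mxE; ring. Qed.

Lemma lorentzDr u v w : lorentz w (u + v) = lorentz w u + lorentz w v.
Proof. by rewrite lorentzC lorentzDl !(lorentzC w). Qed.

Lemma lorentzZr a u v : lorentz u (a *: v) = a * lorentz u v.
Proof. by rewrite lorentzC lorentzZl lorentzC. Qed.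

Lemma lorentzNl u v : lorentz (- u) v = - lorentz u v.
Proof. by rewrite -scaleN1r lorentzZl mulN1r. Qed.

Lemma lorentzNr u v : lorentz u (- v) = - lorentz u v.
Proof. by rewrite lorentzC lorentzNl lorentzC. Qed.

Lemma lorentz0l u : lorentz 0 u = 0.
Proof. by rewrite -(scale0r 0) lorentzZl mul0r. Qed.

Lemma lorentz_is_linear v : linear (fun u => lorentz u v).
Proof. by move=> a x y; rewrite lorentzDl lorentzZl. Qed.

(** A named head with the first argument last, so that linearity in that argument can be declared as
    a structure and the derivative rules for linear maps apply. *)
Definition lorentzr v u := lorentz u v.

HB.instance Definition _ v :=
  GRing.isLinear.Build R 'rV[R]_4 R *:%R (lorentzr v) (lorentz_is_linear v).

Definition lorentzL := (lorentzDl, lorentzDr, lorentzNl, lorentzNr,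
  lorentzZl, lorentzZr).

Lemma row4P u v : u 0 0 = v 0 0 -> u 0 1 = v 0 1 ->
  u 0 2%:R = v 0 2%:R -> u 0 3%:R = v 0 3%:R -> u = v.
Proof.
move=> h0 h1 h2 h3; apply/rowP => i.
have : i \in [:: 0; 1; 2%:R; 3%:R] by case: i => [[|[|[|[|]]]] ?].
by rewrite !inE => /or4P[] /eqP->.
Qed.

(* Cauchy-Schwarz on the spatial parts q', u':
   (q_0 u_0)^2 = (q' . u')^2 <= |q'|^2 |u'|^2, while |q'| < |q_0|. *)
Lemma orth_timelike_spacelike q u :
  lorentz q q < 0 -> lorentz u q = 0 -> u != 0 -> 0 < lorentz u u.
Proof.
rewrite !lorentzE.
set q0 := q 0 0; set q1 := q 0 1; set q2 := q 0 2%:R; set q3 := q 0 3%:R.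
move=> hq hu un0.
set u0 := u 0 0 in hu *; set u1 := u 0 1 in hu *; set u2 := u 0 2%:R in hu *.
set u3 := u 0 3%:R in hu *.
have q0n : 0 < q0 ^+ 2 by nra.
have h1 : u0 * q0 = u1 * q1 + u2 * q2 + u3 * q3 by lra.
have h2 : (u0 * q0) ^+ 2 <=
    (u1 ^+ 2 + u2 ^+ 2 + u3 ^+ 2) * (q1 ^+ 2 + q2 ^+ 2 + q3 ^+ 2).
  rewrite h1 -subr_ge0.
  have -> : (u1 ^+ 2 + u2 ^+ 2 + u3 ^+ 2) * (q1 ^+ 2 + q2 ^+ 2 + q3 ^+ 2) -
    (u1 * q1 + u2 * q2 + u3 * q3) ^+ 2 =
    (u1 * q2 - u2 * q1) ^+ 2 + (u1 * q3 - u3 * q1) ^+ 2 +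
    (u2 * q3 - u3 * q2) ^+ 2 by ring.
  by rewrite !addr_ge0// sqr_ge0.
have [s0|s0] := ltP 0 (u1 ^+ 2 + u2 ^+ 2 + u3 ^+ 2).
  have h3 : u0 ^+ 2 * q0 ^+ 2 < (u1 ^+ 2 + u2 ^+ 2 + u3 ^+ 2) * q0 ^+ 2.
    rewrite -exprMn (le_lt_trans h2)// ltr_pM2l//; lra.
  by move: h3; rewrite ltr_pM2r//; lra.
have z1 : u1 = 0.
  by apply/eqP; rewrite -sqrf_eq0 eq_le sqr_ge0 andbT; have := sqr_ge0 u2;
     have := sqr_ge0 u3; lra.
have z2 : u2 = 0.
  by apply/eqP; rewrite -sqrf_eq0 eq_le sqr_ge0 andbT; have := sqr_ge0 u1;
     have := sqr_ge0 u3; lra.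
have z3 : u3 = 0.
  by apply/eqP; rewrite -sqrf_eq0 eq_le sqr_ge0 andbT; have := sqr_ge0 u1;
     have := sqr_ge0 u2; lra.
have z0 : u0 = 0.
  move/eqP: h1; rewrite z1 z2 z3 !mul0r !addr0 mulf_eq0 => /orP[/eqP//|].
  by rewrite -sqrf_eq0 => /eqP q00; rewrite q00 ltxx in q0n.
by case/eqP: un0; apply: row4P; rewrite !mxE.
Qed.

Lemma future_timelike p q : lorentz q q < 0 -> 0 < q 0 0 ->
  lorentz p p < 0 -> lorentz p q < 0 -> 0 < p 0 0.
Proof.
move=> qq q0 pp pq; rewrite ltNge; apply/negP => p0.
(* Up to a scalar, the point where the segment from [p] to [q] crosses the
   spacelike hyperplane of vanishing time coordinate. *)
pose z := q 0 0 *: p - p 0 0 *: q.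
have z0 : z 0 0 = 0 by rewrite !mxE; ring.
have zz : 0 <= lorentz z z.
  by rewrite lorentzE z0 mulr0 oppr0 add0r !addr_ge0// -expr2 sqr_ge0.
(* With [p 0 0 <= 0], no term in the expansion of [<z, z>] is positive, and the one with [<p, p>] is
   negative. *)
have : lorentz z z < 0.
  have h1 : q 0 0 ^+ 2 * lorentz p p < 0 by rewrite pmulr_rlt0// exprn_gt0.
  have h2 : p 0 0 ^+ 2 * lorentz q q <= 0.
    by rewrite mulr_ge0_le0 ?sqr_ge0// ltW.
  have h3 : 0 <= (q 0 0 * p 0 0) * lorentz p q.
    by apply: mulr_le0; [apply: mulr_ge0_le0 => //; exact: ltW|exact: ltW].
  by rewrite /z !lorentzL (lorentzC q p); nra.
by rewrite ltNge zz.
Qed.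

End LorentzAlgebra.

Section Rotations.
Variable R : realType.
Implicit Types (u v w p q nu e : 'rV[R]_4) (a b t : R).

Definition minkowski_mx : 'M[R]_4 :=
  diag_mx (\row_i (if i == 0 then -1 else 1)).

Lemma lorentz_mx u v : u *m minkowski_mx *m v^T = (lorentz u v)%:M.
Proof.
apply/matrixP => i j; rewrite !ord1 !mxE eqxx mulr1n.
rewrite !big_ord_recl big_ord0 addr0 /lorentz !big_ord_recl big_ord0 addr0.
rewrite mul_mx_diag !mxE /=.
by rewrite mulrN1 mulNr !mulr1 !addrA.
Qed.

Lemma minkowski_mxK : minkowski_mx *m minkowski_mx = 1%:M.
Proof.
rewrite /minkowski_mx mulmx_diag; apply/matrixP => i j; rewrite !mxE.
by case: ifP => _; rewrite ?mulN1r ?opprK ?mulr1.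
Qed.

Lemma matrix_action (A B : 'M[R]_4) :
  (forall q, q *m A = q *m B) -> A = B.
Proof. by move=> AB; apply/row_matrixP => i; rewrite !rowE. Qed.

(* The generator J of the rotations fixing the orthogonal complement of [nu]
   and [e]; if [e] is unit and orthogonal to [nu], then J^3 = - <nu, nu> J. *)
Definition rot_gen nu e : 'M[R]_4 :=
  minkowski_mx *m (nu^T *m e - e^T *m nu).

Lemma rot_genE nu e q :
  q *m rot_gen nu e = lorentz q nu *: e - lorentz q e *: nu.
Proof.
by rewrite /rot_gen mulmxA mulmxBr !mulmxA !lorentz_mx !mul_scalar_mx.
Qed.

(** When [e] is a unit vector orthogonal to [nu], [J^3] is a multiple of [J], so every polynomial in
    [J] with constant term 1 has this form. *)
Definition rot_mx nu e a b : 'M[R]_4 :=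
  1%:M + a *: rot_gen nu e + b *: (rot_gen nu e *m rot_gen nu e).

Lemma rot_mxE nu e a b q : lorentz nu e = 0 -> lorentz e e = 1 ->
  q *m rot_mx nu e a b =
  q + (a * lorentz q nu - b * lorentz nu nu * lorentz q e) *: e
    - (a * lorentz q e + b * lorentz q nu) *: nu.
Proof.
move=> ne ee; rewrite /rot_mx !mulmxDr mulmx1 -!scalemxAr.
rewrite (mulmxA q (rot_gen nu e)) !rot_genE.
rewrite !lorentzL ne ee (lorentzC e nu) ne.
by apply/rowP => i; rewrite !mxE; ring.
Qed.

(** [1 + t J] is [minkowski_mx] times [minkowski_mx + t K] with [K] skew-symmetric, and transposing
    the second factor changes the sign of [t]. So numerator and denominator of the Cayley transform
    have equal determinants. *)
Lemma det_rot_gen nu e t :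
  \det (1%:M + t *: rot_gen nu e) = \det (1%:M - t *: rot_gen nu e).
Proof.
pose K := nu^T *m e - e^T *m nu.
have KT : K^T = - K by rewrite /K linearB /= !trmx_mul !trmxK opprB.
have E s : 1%:M + s *: rot_gen nu e = minkowski_mx *m (minkowski_mx + s *: K).
  by rewrite mulmxDr minkowski_mxK -scalemxAr.
rewrite -scaleNr !E !det_mulmx -(det_tr (_ + t *: K)); congr (_ * \det _).
by rewrite linearD /= linearZ /= KT tr_diag_mx scalerN scaleNr.
Qed.

(* The Cayley transform (1 + t J)(1 - t J)^-1 is rational in t and covers the
   elliptic, hyperbolic and parabolic rotations at once. *)
Lemma rot_mx_cayley nu e t a b : lorentz nu e = 0 -> lorentz e e = 1 ->
  a * (1 + lorentz nu nu * t ^+ 2) = 2 * t -> b = t * a ->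
  rot_mx nu e a b *m (1%:M - t *: rot_gen nu e) = 1%:M + t *: rot_gen nu e.
Proof.
move=> ne ee ha hb; apply: matrix_action => q.
rewrite mulmxA rot_mxE// mulmxBr mulmxDr !mulmx1 -!scalemxAr !rot_genE.
rewrite !lorentzL ne ee (lorentzC e nu) ne hb.
set c := lorentz nu nu in ha *.
apply/rowP => i; rewrite !mxE; apply/eqP; rewrite -subr_eq0; apply/eqP.
transitivity ((a * (1 + c * t ^+ 2) - 2 * t) *
    (lorentz q nu * e 0 i - lorentz q e * nu 0 i)); first by ring.
by rewrite ha subrr mul0r.
Qed.

Lemma det_rot_mx nu e t a b : lorentz nu e = 0 -> lorentz e e = 1 ->
  1 + lorentz nu nu * t ^+ 2 != 0 ->
  a * (1 + lorentz nu nu * t ^+ 2) = 2 * t -> b = t * a ->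
  \det (rot_mx nu e a b) = 1.
Proof.
move=> ne ee d0 ha hb.
have := congr1 determinant (rot_mx_cayley ne ee ha hb).
rewrite det_mulmx det_rot_gen -[RHS]mul1r => /mulIf; apply.
(* It remains that [1 - t J] is invertible: a kernel vector [q = t q J] is a combination of [nu] and
   [e], and its products with both force [<q, nu> (1 + <nu, nu> t^2) = 0]. *)
apply/det0P => -[q q0]; rewrite mulmxBr mulmx1 -scalemxAr rot_genE.
move=> /eqP; rewrite subr_eq0 => /eqP qE.
have qn : lorentz q nu = - t * lorentz nu nu * lorentz q e.
  by rewrite {1}qE !lorentzL (lorentzC e) ne; ring.
have qe : lorentz q e = t * lorentz q nu by rewrite {1}qE !lorentzL ne ee; ring.
have /eqP : lorentz q nu * (1 + lorentz nu nu * t ^+ 2) = 0.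
  by rewrite mulrDr mulr1 {1}qn qe; ring.
rewrite mulf_eq0 (negPf d0) orbF => /eqP qn0.
by move: q0; rewrite qE qe qn0 mulr0 !scale0r subrr scaler0 eqxx.
Qed.

(** The adjoint of [J] is [- J], and [(1 + a J + b J^2) (1 - a J + b J^2) = 1 + (2 b - a^2 - <nu,
    nu> b^2) J^2] because [J^4 = - <nu, nu> J^2]. *)
Lemma lorentz_rot_mx nu e a b u v : lorentz nu e = 0 -> lorentz e e = 1 ->
  a ^+ 2 + lorentz nu nu * b ^+ 2 = 2 * b ->
  lorentz (u *m rot_mx nu e a b) (v *m rot_mx nu e a b) = lorentz u v.
Proof.
move=> ne ee h; rewrite !rot_mxE// !lorentzL (lorentzC e v) (lorentzC nu v).
rewrite (lorentzC e nu) ne ee.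
set c := lorentz nu nu in h *.
apply/eqP; rewrite -subr_eq0; apply/eqP.
transitivity ((a ^+ 2 + c * b ^+ 2 - 2 * b) *
  (lorentz u nu * lorentz v nu + c * (lorentz u e * lorentz v e))); last first.
  by rewrite h subrr mul0r.
by ring.
Qed.

Lemma rot_mx_revolution_group r (P : {vspace 'rV[R]_4}) nu e t a b :
  0 < r -> lorentz nu e = 0 -> lorentz e e = 1 ->
  (forall p, p \in P -> lorentz p nu = 0 /\ lorentz p e = 0) ->
  0 < 1 + lorentz nu nu * t ^+ 2 ->
  a * (1 + lorentz nu nu * t ^+ 2) = 2 * t -> b = t * a ->
  revolution_group r P (rot_mx nu e a b).
Proof.
move=> r0 ne ee hP d0 ha hb.
have hab : a ^+ 2 + lorentz nu nu * b ^+ 2 = 2 * b.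
  rewrite hb; transitivity (a * (a * (1 + lorentz nu nu * t ^+ 2))); first ring.
  by rewrite ha; ring.
have b0 : 0 <= b.
  rewrite hb -(pmulr_lge0 _ d0) -mulrA ha.
  by have := sqr_ge0 t; lra.
split=> [u v||p pP|q [qq q0]].
- exact: lorentz_rot_mx.
- by rewrite (det_rot_mx ne ee _ ha hb)// gt_eqF.
- by have [pn pe] := hP p pP; rewrite rot_mxE// pn pe !mulr0 subrr addr0
    !scale0r addr0 subr0.
- have r20 : - r ^+ 2 < 0 by rewrite oppr_lt0 exprn_gt0.
  have AA : lorentz (q *m rot_mx nu e a b) (q *m rot_mx nu e a b) = - r ^+ 2.
    by rewrite lorentz_rot_mx.
  split=> //; apply: (@future_timelike R _ q); rewrite ?qq ?AA//.
  (* As [J] is skew, [y] is orthogonal to the timelike [q], hence spacelike or zero, and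
     [<q J^2, q> = - <y, y>]. With [b >= 0] the image of [q] therefore has negative product with [q]
     and stays on the same sheet. *)
  pose y := q *m rot_gen nu e.
  have yy : 0 <= lorentz y y.
    have [->|y0] := eqVneq y 0; first by rewrite lorentz0l.
    apply/ltW/(@orth_timelike_spacelike R q); rewrite ?qq//.
    by rewrite /y rot_genE !lorentzL !(lorentzC _ q); ring.
  have -> : lorentz (q *m rot_mx nu e a b) q = - r ^+ 2 - b * lorentz y y.
    rewrite /y rot_mxE// rot_genE !lorentzL ne ee !(lorentzC _ q) qq.
    by rewrite (lorentzC e nu) ne; ring.
  by have := mulr_ge0 b0 yy; lra.
Qed.

End Rotations.

(** * Unit normals, conormals and orthogonal frames *)

Section Subspaces.
Variable R : realType.
Implicit Types (u q nu e : 'rV[R]_4).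

Lemma lorentz_row n (B : 'M[R]_(n, 4)) u i :
  (u *m (minkowski_mx R *m B^T)) 0 i = lorentz u (row i B).
Proof.
transitivity ((u *m minkowski_mx R *m (row i B)^T) 0 0); last first.
  by rewrite lorentz_mx mxE eqxx mulr1n.
by rewrite mulmxA !mxE; apply: eq_bigr => j _; rewrite !mxE.
Qed.

Lemma exists_orth3 (x y z : 'rV[R]_4) : exists u : 'rV[R]_4,
  [/\ u != 0, lorentz u x = 0, lorentz u y = 0 & lorentz u z = 0].
Proof.
pose B : 'M[R]_(3, 4) := \matrix_(i < 3) nth 0 [:: x; y; z] i.
pose K := kermx (minkowski_mx R *m B^T).
have K0 : K != 0.
  rewrite -mxrank_eq0 mxrank_ker subn_eq0 -ltnNge.
  exact: leq_ltn_trans (rank_leq_col _) _.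
have [u uK u0] := rowV0Pn K0.
have uB (i : 'I_3) : lorentz u (nth 0 [:: x; y; z] i) = 0.
  by rewrite -(rowK (fun i : 'I_3 => nth 0 [:: x; y; z] i)) -lorentz_row
    (sub_kermxP uK) mxE.
by exists u; split; [|exact: (uB 0)|exact: (uB 1)|exact: (uB 2%:R)].
Qed.

(** A vector orthogonal to [P] is orthogonal to the timelike [q], hence spacelike, and can be
    normalized. *)
Lemma exists_unit_normal (P : {vspace 'rV[R]_4}) q : \dim P = 3%N ->
  q \in P -> lorentz q q < 0 ->
  exists2 e, lorentz e e = 1 & forall p, p \in P -> lorentz p e = 0.
Proof.
move=> dP qP qq; have [u [u0 hx hy hz]] :=
  exists_orth3 (vbasis P)`_0 (vbasis P)`_1 (vbasis P)`_2.
have Pu p : p \in P -> lorentz p u = 0.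
  move=> /coord_vbasis ->; rewrite -[lorentz _ _]/(lorentzr u _) linear_sum.
  rewrite big1// => i _.
  rewrite linearZ /= /lorentzr lorentzC.
  have : (i < 3)%N := leq_trans (ltn_ord i) (eq_leq dP).
  by case: (i : nat) => [|[|[|//]]] _; rewrite ?hx ?hy ?hz scaler0.
have uu : 0 < lorentz u u.
  by apply: orth_timelike_spacelike qq _ u0; rewrite lorentzC Pu.
exists ((Num.sqrt (lorentz u u))^-1 *: u); last first.
  by move=> p pP; rewrite !lorentzL (Pu p)// mulr0.
by rewrite !lorentzL mulrA -expr2 exprVn sqr_sqrtr ?ltW// mulVf ?gt_eqF.
Qed.

(** If [<q, nu>] vanished, [nu] would be orthogonal to [P2 + <[q]>], which is all of [P3] and
    contains [nu], so [nu] would be null; but a nonzero vector orthogonal to the timelike [q] is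
    spacelike. *)
Lemma conormal_neq0 (P2 P3 : {vspace 'rV[R]_4}) nu q :
  \dim P2 = 2%N -> \dim P3 = 3%N -> (P2 <= P3)%VS ->
  q \in P3 -> q \notin P2 -> lorentz q q < 0 -> conormal P2 P3 nu ->
  lorentz q nu != 0.
Proof.
move=> d2 d3 s23 q3 q2 qq [nu3 nu0 nuP]; apply/eqP => qnu.
have PE : P3 = (P2 + <[q]>)%VS.
  apply/esym/eqP; rewrite eqEdim subv_add s23 -memvE q3/= d3.
  have q0 : q != 0 by apply: contraNneq q2 => ->; rewrite mem0v.
  rewrite dimv_disjoint_sum ?d2 ?dim_vline ?q0//.
  apply/eqP; rewrite -subv0; apply/subvP => v.
  rewrite memv_cap => /andP[v2 /vlineP[k vE]]; move: v2; rewrite vE.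
  have [->|k0] := eqVneq k 0; first by rewrite scale0r !mem0v.
  by rewrite rpredZeq (negPf k0) (negPf q2).
have := orth_timelike_spacelike qq (etrans (lorentzC _ _) qnu) nu0.
move: nu3; rewrite PE => /memv_addP[v v2 [w /vlineP[k ->] nuE]].
by rewrite {2}nuE !lorentzL nuP// (lorentzC nu q) qnu mulr0 addr0 ltxx.
Qed.

(** The Gram matrix of the frame is diagonal with nonzero entries, so the frame is a basis and the
    only vector orthogonal to all of it is 0; this is applied to the difference of both sides. *)
Lemma frame_decomposition (g d e n w : 'rV[R]_4) :
  lorentz g g < 0 -> 0 < lorentz d d -> lorentz e e = 1 -> lorentz n n = 1 ->
  lorentz g d = 0 -> lorentz g e = 0 -> lorentz g n = 0 ->
  lorentz d e = 0 -> lorentz d n = 0 -> lorentz e n = 0 ->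
  lorentz w g = 0 -> lorentz w e = 0 ->
  w = (lorentz w d / lorentz d d) *: d + lorentz w n *: n.
Proof.
move=> gg dd ee nn gd ge gn de dn en wg we.
pose u := w - ((lorentz w d / lorentz d d) *: d + lorentz w n *: n).
suff : u = 0 by move/eqP; rewrite subr_eq0 => /eqP.
have ug : lorentz u g = 0.
  by rewrite /u !lorentzL wg (lorentzC d) gd (lorentzC n) gn; ring.
have ud : lorentz u d = 0.
  by rewrite /u !lorentzL (lorentzC n) dn divfK ?gt_eqF//; ring.
have ue : lorentz u e = 0.
  by rewrite /u !lorentzL we de (lorentzC n) en; ring.
have un : lorentz u n = 0.
  by rewrite /u !lorentzL dn nn; ring.
pose B : 'M[R]_4 := \matrix_(i < 4) nth 0 [:: g; d; e; n] i.
have rB i : row i B = nth 0 [:: g; d; e; n] i by apply/rowP => j; rewrite !mxE.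
pose D : 'rV[R]_4 := \row_i nth 0 [:: lorentz g g; lorentz d d; 1; 1] i.
have BB : B *m (minkowski_mx R *m B^T) = diag_mx D.
  apply/row_matrixP => i; apply/rowP => j.
  rewrite row_mul lorentz_row !rB !mxE.
  case: i => [[|[|[|[|//]]]] Hi]; case: j => [[|[|[|[|//]]]] Hj];
  by rewrite /= ?mulr1n ?mulr0n ?gd ?ge ?gn ?de ?dn ?en ?ee ?nn //
    lorentzC ?gd ?ge ?gn ?de ?dn ?en.
have Bu : B \in unitmx.
  have : B *m (minkowski_mx R *m B^T) \in unitmx.
    rewrite BB unitmxE det_diag unitfE; apply/prodf_neq0 => i _; rewrite mxE.
    case: i => [[|[|[|[|//]]]] Hi] /=; rewrite ?oner_neq0 ?(lt_eqF gg)//.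
    by rewrite gt_eqF.
  by rewrite unitmx_mul => /andP[].
have Mu : minkowski_mx R *m B^T \in unitmx.
  rewrite unitmx_mul unitmx_tr Bu andbT.
  by have [] := mulmx1_unit (minkowski_mxK R).
apply: (can_inj (mulmxK Mu)); rewrite mul0mx; apply/rowP => i.
rewrite lorentz_row rB mxE.
by case: i => [[|[|[|[|//]]]] Hi].
Qed.

End Subspaces.

(** * Smooth functions *)

Section Smoothness.
Variable R : realType.

Lemma near_eq_differentiable (V W : normedModType R) (f g : V -> W) (x : V) :
  {near x, f =1 g} -> differentiable f x -> differentiable g x.
Proof.
move=> fg /diff_locallyP[dc fE].
have gE : g \o shift x = cst (g x) + 'd f x +o_ 0 id.
  apply/eqaddoP => e e0; move/eqaddoP: fE => /(_ e e0).
  have : \forall h \near 0, f (h + x) = g (h + x).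
    move: fg; rewrite (near_shift 0)/= subr0.
    by apply: filterS => h; rewrite /= addrC.
  apply: filterS2 => h fgh; rewrite /= !fctE /= fgh.
  by rewrite (nbhs_singleton fg).
apply/diff_locallyP; have dE := diff_unique dc gE.
by split; rewrite dE.
Qed.

Lemma is_derive_linear (U V W : normedModType R) (L : {linear V -> W})
    (f : U -> V) (x v : U) (df : V) : continuous L ->
  is_derive x v f df -> is_derive x v (L \o f) (L df).
Proof.
move=> cL [fd <-].
have E : h^-1 *: (((L \o f) \o shift x) (h *: v) - (L \o f) x) @[h --> 0^']
    --> L ('D_v f x).
  rewrite (_ : (fun h => _) =
      fun h : R => L (h^-1 *: ((f \o shift x) (h *: v) - f x))); last first.
    apply/funext => h /=; by rewrite [RHS]linearZ [in RHS]linearB.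
  exact: (@cvg_comp _ _ _ (fun h => h^-1 *: ((f \o shift x) (h *: v) - f x)) L
    _ _ _ fd (cL _)).
by apply: DeriveDef; [apply/cvg_ex; exists (L ('D_v f x))|exact: cvg_lim].
Qed.

Lemma derive_comp_linear (U V W : normedModType R) (L : {linear U -> V})
    (f : V -> W) (x v : U) : 'D_v (f \o L) x = 'D_(L v) f (L x).
Proof.
rewrite /derive; set F := fun h => _; set G := fun h => _.
suff -> : F = G by [].
by apply/funext => h; rewrite /F /G /= linearP.
Qed.

Section DifferentiableUpTo.
Variables (V : normedModType R) (U : set V).
Hypothesis oU : open U.

(* Truncates the order in [smooth_on], for inductions on the order. *)
Definition diff_upto (W : normedModType R) n (f : V -> W) := forall vs,
  (size vs <= n)%N -> forall x, U x ->
  differentiable (foldr (fun v g => 'D_v g) f vs) x.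

(** [foldr] applies the last direction of the list first, so the derivative split off here is the
    innermost one and sits at the end of the list. *)
Lemma diff_uptoS (W : normedModType R) n (f : V -> W) :
  diff_upto n.+1 f <->
  (forall x, U x -> differentiable f x) /\ forall v, diff_upto n ('D_v f).
Proof.
split=> [Df|[Df DDf] vs].
  split=> [x Ux|v vs svs x Ux]; first exact: (Df [::]).
  by have := Df (rcons vs v); rewrite size_rcons foldr_rcons; apply.
case/lastP: vs => [_|vs v]; first exact: Df.
by rewrite size_rcons ltnS foldr_rcons; exact: DDf.
Qed.

Lemma diff_uptoW (W : normedModType R) n (f : V -> W) :
  diff_upto n.+1 f -> diff_upto n f.
Proof. by move=> Df vs svs; apply: Df; rewrite (leq_trans svs). Qed.

Lemma diff_upto0 (W : normedModType R) n (f : V -> W) x :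
  diff_upto n f -> U x -> differentiable f x.
Proof. by move=> /(_ [::]); apply. Qed.

Lemma near_open (W : normedModType R) (f g : V -> W) x :
  (forall y, U y -> f y = g y) -> U x -> {near x, f =1 g}.
Proof. by move=> fg Ux; apply: filterS (open_nbhs_nbhs (conj oU Ux)). Qed.

(** The differentiation rules are available only on [U]; as [U] is open, an equality there is an
    equality of germs and survives further derivatives. *)
Lemma eq_diff_upto (W : normedModType R) n (f g : V -> W) :
  (forall x, U x -> f x = g x) -> diff_upto n f -> diff_upto n g.
Proof.
elim: n f g => [|n IHn] f g fg.
  move=> Df [|//] _ x Ux /=.
  exact: near_eq_differentiable (near_open fg Ux) (Df [::] _ _ Ux).
move=> /diff_uptoS[Df DDf]; apply/diff_uptoS; split=> [x Ux|v].
  exact: near_eq_differentiable (near_open fg Ux) (Df x Ux).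
apply: IHn (DDf v) => x Ux.
exact: near_eq_derive (near_open fg Ux).
Qed.

Lemma diff_upto_linear (W W' : normedModType R) (L : {linear W -> W'}) n
    (f : V -> W) :
  continuous L -> diff_upto n f -> diff_upto n (L \o f).
Proof.
move=> cL; elim: n f => [|n IHn] f Df.
  move=> [|//] _ x Ux /=; apply: differentiable_comp; first exact: (Df [::]).
  exact: linear_differentiable.
have [Df0 DDf] := (diff_uptoS _ _).1 Df.
apply/diff_uptoS; split=> [x Ux|v].
  apply: differentiable_comp; first exact: Df0.
  exact: linear_differentiable.
apply: eq_diff_upto (IHn _ (DDf v)) => x Ux /=.
by have [_ ->] :=
  is_derive_linear cL (derivableP (diff_derivable (v := v) (Df0 x Ux))).
Qed.

Lemma diff_uptoD (W : normedModType R) n (f g : V -> W) :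
  diff_upto n f -> diff_upto n g -> diff_upto n (fun x => f x + g x).
Proof.
elim: n f g => [|n IHn] f g Df Dg.
  move=> [|//] _ x Ux.
  by apply: differentiableD; [exact: diff_upto0 Df Ux|exact: diff_upto0 Dg Ux].
have [Df0 DDf] := (diff_uptoS _ _).1 Df.
have [Dg0 DDg] := (diff_uptoS _ _).1 Dg.
apply/diff_uptoS; split=> [x Ux|v].
  by apply: differentiableD; [exact: Df0|exact: Dg0].
apply: eq_diff_upto (IHn _ _ (DDf v) (DDg v)) => x Ux /=.
by rewrite -deriveD//; apply: diff_derivable; [exact: Df0|exact: Dg0].
Qed.

Lemma diff_uptoM n (f g : V -> R) :
  diff_upto n f -> diff_upto n g -> diff_upto n (fun x => f x * g x).
Proof.
elim: n f g => [|n IHn] f g Df Dg.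
  move=> [|//] _ x Ux.
  by apply: differentiableM; [exact: diff_upto0 Df Ux|exact: diff_upto0 Dg Ux].
have [Df0 DDf] := (diff_uptoS _ _).1 Df.
have [Dg0 DDg] := (diff_uptoS _ _).1 Dg.
apply/diff_uptoS; split=> [x Ux|v].
  by apply: differentiableM; [exact: Df0|exact: Dg0].
apply: eq_diff_upto (diff_uptoD (IHn _ _ (diff_uptoW Df) (DDg v))
  (IHn _ _ (diff_uptoW Dg) (DDf v))) => x Ux /=.
by rewrite -deriveM//; apply: diff_derivable; [exact: Df0|exact: Dg0].
Qed.

Lemma diff_upto_cst (W : normedModType R) n (w : W) : diff_upto n (fun _ => w).
Proof.
move=> vs _ x Ux.
suff [c ->] : exists c : W, foldr (fun v g => 'D_v g) (fun _ => w) vs = cst c.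
  exact: differentiable_cst.
elim: vs => [|v vs [c cE]] /=; first by exists w.
exists 0; apply/funext => y; rewrite cE.
exact: derive_cst.
Qed.

Lemma diff_uptoV n (f : V -> R) : (forall x, U x -> f x != 0) ->
  diff_upto n f -> diff_upto n (fun x => (f x)^-1).
Proof.
move=> f0; elim: n => [|n IHn] Df.
  move=> [|//] _ x Ux.
  by apply: differentiableV; [exact: diff_upto0 Df Ux|exact: f0].
have [Df0 DDf] := (diff_uptoS _ _).1 Df.
apply/diff_uptoS; split=> [x Ux|v].
  by apply: differentiableV; [exact: Df0|exact: f0].
have Vf := IHn (diff_uptoW Df).
apply: eq_diff_upto (diff_uptoM (@diff_upto_cst _ n (-1 : R))
  (diff_uptoM (diff_uptoM Vf Vf) (DDf v))) => x Ux /=.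
rewrite deriveV//; [|exact: f0|exact/diff_derivable/Df0].
by rewrite scaleNr -exprVn expr2 mulN1r.
Qed.

(** Iterated derivatives of [f \o L] are those of [f] along the images of the directions, so
    composition with a projection needs no higher chain rule. *)
Lemma diff_upto_comp_linear (V' W : normedModType R) (L : {linear V -> V'})
    (A : set V') n (f : V' -> W) : continuous L ->
  (forall x, U x -> A (L x)) ->
  (forall vs y, A y -> differentiable (foldr (fun v g => 'D_v g) f vs) y) ->
  diff_upto n (f \o L).
Proof.
move=> cL UA Df vs _ x Ux.
have -> : foldr (fun v g => 'D_v g) (f \o L) vs =
    (foldr (fun v g => 'D_v g) f (map L vs)) \o L.
  elim: vs => //= v vs ->; apply/funext => y /=.
  exact: derive_comp_linear.
apply: differentiable_comp; first exact: linear_differentiable.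
exact/Df/UA.
Qed.

Lemma diff_upto_linear_fun (W : normedModType R) (L : {linear V -> W}) n :
  continuous L -> diff_upto n L.
Proof.
move=> cL; case: n => [|n].
  by move=> [|//] _ x _; exact: linear_differentiable.
apply/diff_uptoS; split=> [x _|v]; first exact: linear_differentiable.
apply: eq_diff_upto (@diff_upto_cst _ n (L v)) => x Ux.
by rewrite deriveE ?diff_lin//; exact: linear_differentiable.
Qed.

Lemma diff_upto_smooth (W : normedModType R) (f : V -> W) :
  (forall n, diff_upto n f) -> smooth_on U f.
Proof.
move=> Df; exists U; first by split.
by move=> vs; exact: Df (size vs) vs (leqnn _).
Qed.

End DifferentiableUpTo.

End Smoothness.

Section PartialDerivatives.
Variable R : realType.

Let shift_snd (h x y : R) :
  h *: ((0, 1) : R * R) + (x, y) = (x, h *: (1 : R) + y).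
Proof. by apply/pair_equal_spec; split; rewrite /= ?scaler0 ?add0r. Qed.

Let shift_fst (h x y : R) :
  h *: ((1, 0) : R * R) + (x, y) = (h *: (1 : R) + x, y).
Proof. by apply/pair_equal_spec; split; rewrite /= ?scaler0 ?add0r. Qed.

Lemma partial_sndE (W : normedModType R) (f : R * R -> W) (x y : R) :
  'D_(0, 1) f (x, y) = 'D_1 (fun t => f (x, t)) y.
Proof.
rewrite /derive; set F := fun h => _; set G := fun h => _.
suff -> : F = G by [].
by apply/funext => h; rewrite /F /G /= shift_snd.
Qed.

Lemma derivable_partial_snd (W : normedModType R) (f : R * R -> W) (x y : R) :
  derivable f (x, y) (0, 1) = derivable (fun t => f (x, t)) y 1.
Proof.
rewrite /derivable; set F := fun h => _; set G := fun h => _.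
suff -> : F = G by [].
by apply/funext => h; rewrite /F /G /= shift_snd.
Qed.

Lemma partial_fstE (W : normedModType R) (f : R * R -> W) (x y : R) :
  'D_(1, 0) f (x, y) = 'D_1 (fun s => f (s, y)) x.
Proof.
rewrite /derive; set F := fun h => _; set G := fun h => _.
suff -> : F = G by [].
by apply/funext => h; rewrite /F /G /= shift_fst.
Qed.

Lemma derivable_partial_fst (W : normedModType R) (f : R * R -> W) (x y : R) :
  derivable f (x, y) (1, 0) = derivable (fun s => f (s, y)) x 1.
Proof.
rewrite /derivable; set F := fun h => _; set G := fun h => _.
suff -> : F = G by [].
by apply/funext => h; rewrite /F /G /= shift_fst.
Qed.

End PartialDerivatives.

Section LorentzCalculus.
Variable R : realType.

Lemma continuous_coord (i : 'I_4) : continuous (fun u : 'rV[R]_4 => u 0 i).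
Proof. move=> u; exact/differentiable_continuous/differentiable_coord. Qed.

Lemma continuous_lorentz (T : topologicalType) (f g : T -> 'rV[R]_4) x :
  {for x, continuous f} -> {for x, continuous g} ->
  {for x, continuous (fun y => lorentz (f y) (g y))}.
Proof.
move=> cf cg.
have cc (h : T -> 'rV[R]_4) i : {for x, continuous h} ->
    (fun y => h y 0 i) @ x --> h x 0 i.
  by move=> ch; exact: (@cvg_comp _ _ _ h (fun u : 'rV[R]_4 => u 0 i) _ _ _ ch
    (@continuous_coord i (h x))).
rewrite /prop_for /continuous_at lorentzE.
rewrite (_ : (fun y => _) = fun y => - (f y 0 0 * g y 0 0) + f y 0 1 * g y 0 1
  + f y 0 2%:R * g y 0 2%:R + f y 0 3%:R * g y 0 3%:R); last first.
  by apply/funext => y; rewrite lorentzE.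
by apply: cvgD; [apply: cvgD; [apply: cvgD; [apply: cvgN|]|]|];
  apply: cvgM; exact: cc.
Qed.

Lemma continuous_lorentzr v : continuous (@lorentzr R v).
Proof.
move=> x.
exact: (@continuous_lorentz _ id (cst v) x (@cvg_id _ _)
  (@cst_continuous _ _ _ _)).
Qed.

Lemma is_derive_coord (V : normedModType R) (f : V -> 'rV[R]_4) x v df i :
  is_derive x v f df -> is_derive x v (fun y => f y 0 i) (df 0 i).
Proof.
move=> [fd <-]; apply: DeriveDef; first exact: (derivable_mxP _ _ _).1.
by rewrite (derive_mx fd) mxE.
Qed.

Lemma is_derive_lorentz (V : normedModType R) (f g : V -> 'rV[R]_4) x v df dg :
  is_derive x v f df -> is_derive x v g dg ->
  is_derive x v (fun y => lorentz (f y) (g y))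
    (lorentz df (g x) + lorentz (f x) dg).
Proof.
move=> fd gd.
have -> : (fun y => lorentz (f y) (g y)) =
    - ((fun y => f y 0 0) * (fun y => g y 0 0))
    + (fun y => f y 0 1) * (fun y => g y 0 1)
    + (fun y => f y 0 2%:R) * (fun y => g y 0 2%:R)
    + (fun y => f y 0 3%:R) * (fun y => g y 0 3%:R).
  by apply/funext => y; rewrite lorentzE.
have dM i := is_deriveM (is_derive_coord i fd) (is_derive_coord i gd).
apply: is_derive_eq (is_deriveD (is_deriveD (is_deriveD (is_deriveN (dM 0))
  (dM 1)) (dM 2%:R)) (dM 3%:R)) _.
by rewrite !lorentzE /GRing.scale /=; ring.
Qed.

Lemma is_derive_lorentz_sqr (V : normedModType R) (f : V -> 'rV[R]_4) x v df :
  is_derive x v f df ->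
  is_derive x v (fun y => lorentz (f y) (f y)) (2 * lorentz df (f x)).
Proof.
move=> fd; apply: is_derive_eq (is_derive_lorentz fd fd) _.
by rewrite (lorentzC (f x)) mulr_natl mulr2n.
Qed.

End LorentzCalculus.

(** * Symmetry of mixed partial derivatives *)

Section Schwarz.
Variable R : realType.

Local Notation ds f := ('D_((1, 0) : R * R) f).
Local Notation dt f := ('D_((0, 1) : R * R) f).

Lemma ler_dist_chain (A B C D e : R) :
  B = D -> `|A - B| < e / 2 -> `|C - D| < e / 2 -> `|A - C| <= e.
Proof.
move=> -> AD CD; rewrite (splitr e) -(subrKA D) (le_trans (ler_normD _ _))//.
by rewrite lerD ?(ltW AD)// distrC ltW.
Qed.

Lemma mean_value (f : R -> R) a h : 0 < h ->
  (forall x, a <= x <= a + h -> derivable f x 1) ->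
  exists2 c, a < c < a + h & f (a + h) - f a = 'D_1 f c * h.
Proof.
move=> h0 fd.
have ah : a < a + h by rewrite ltrDl.
have [|x xah|c cah ->] := @MVT R f ('D_1 f) a (a + h) ah.
- move=> x; rewrite in_itv/= => /andP[/ltW ax /ltW xh].
  by apply: derivableP; apply: fd; rewrite ax xh.
- by apply: derivable_within_continuous => y; rewrite in_itv/=; exact: fd.
- by exists c; [rewrite in_itv/= in cah|rewrite addrAC subrr add0r].
Qed.

(** The mean value theorem is applied twice, first to [f (s, y + h) - f (s, y)] in [s]. Keeping the
    partial derivative [g] abstract lets the lemma serve also for [f] with its variables swapped. *)
Lemma second_difference (f g : R * R -> R) (x y h : R) : 0 < h ->
  (forall s t, x <= s <= x + h -> y <= t <= y + h ->
     is_derive s 1 (fun s => f (s, t)) (g (s, t)) /\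
     derivable (fun t => g (s, t)) t 1) ->
  exists s t, [/\ x < s < x + h, y < t < y + h &
    f (x + h, y + h) - f (x, y + h) - (f (x + h, y) - f (x, y)) =
    'D_1 (fun t => g (s, t)) t * h ^+ 2].
Proof.
move=> h0 fg.
have yy : y <= y <= y + h by rewrite lexx lerDl ltW.
have yh : y <= y + h <= y + h by rewrite lexx lerDl ltW.
have d1 s : x <= s <= x + h ->
    is_derive s 1 (fun s => f (s, y + h) - f (s, y)) (g (s, y + h) - g (s, y)).
  move=> xs; have [fs1 _] := fg s _ xs yh; have [fs2 _] := fg s _ xs yy.
  exact: is_deriveB.
have [s|s xs E1] := @mean_value (fun s => f (s, y + h) - f (s, y)) x h h0.
  by move=> /d1[].
have xs' : x <= s <= x + h by move/andP: xs => [/ltW-> /ltW->].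
have [t|t yt E2] := @mean_value (fun t => g (s, t)) y h h0.
  by move=> yt; have [] := fg s t xs' yt.
exists s, t; split=> //.
transitivity (f (x + h, y + h) - f (x + h, y) - (f (x, y + h) - f (x, y))).
  by ring.
have [_ d1E] := d1 s xs'.
by rewrite E1 d1E E2 -mulrA -expr2.
Qed.

Local Notation swap := (fun p : R * R => (p.2, p.1)).

(* Both mixed derivatives equal, at points close to [p], the second difference
   of [f] on a small square divided by its area. *)
Lemma schwarz (f : R * R -> R) (U : set (R * R)) p : open U -> U p ->
  (forall q, U q -> differentiable f q) ->
  (forall v q, U q -> differentiable ('D_v f) q) ->
  {for p, continuous (ds (dt f))} -> {for p, continuous (dt (ds f))} ->
  ds (dt f) p = dt (ds f) p.
Proof.
case: p => x y oU Up fd Dfd c1 c2.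
apply/eqP; rewrite -subr_eq0 -normr_le0; apply/ler_addgt0Pl => e e0.
rewrite addr0.
have e2 : 0 < e / 2 by rewrite divr_gt0.
have := c1; rewrite /prop_for/continuous_at => /cvgrPdist_lt/(_ _ e2) n1.
have := c2; rewrite /prop_for/continuous_at => /cvgrPdist_lt/(_ _ e2) n2.
have n3 : nbhs (x, y) U by exact: open_nbhs_nbhs.
have [d /= d0 bd] := (nbhs_ballP _ _).1 (filterI n3 (filterI n1 n2)).
pose h := d / 2.
have h0 : 0 < h by rewrite /h divr_gt0.
have hd : h < d by rewrite /h ltr_pdivrMr// ltr_pMr// ltr1n.
have box s t : x <= s <= x + h -> y <= t <= y + h -> ball (x, y) d (s, t).
  move=> /andP[xs sx] /andP[yt ty].
  by split; rewrite /ball /= ler0_norm ?subr_le0//; lra.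
have DdP v w q : U q -> derivable ('D_v f) q w.
  by move=> Uq; exact/diff_derivable/Dfd.
have [s|s [t [xs yt]]] := @second_difference f (ds f) x y h h0.
  move=> t xs yt; have [Us _] := bd _ (box _ _ xs yt); split.
    apply: DeriveDef; last by rewrite partial_fstE.
    by rewrite -derivable_partial_fst; exact/diff_derivable/fd.
  by rewrite -(derivable_partial_snd (ds f)); exact: DdP.
rewrite -(partial_sndE (ds f)) => E1.
have [t'|t' [s' [yt' xs']]] :=
    @second_difference (f \o swap) (dt f \o swap) y x h h0.
  move=> s' yt' xs'; have [Us _] := bd _ (box _ _ xs' yt'); split.
    apply: DeriveDef; last by rewrite /= partial_sndE.
    by rewrite -(derivable_partial_snd f); exact/diff_derivable/fd.
  by rewrite -(derivable_partial_fst (dt f)); exact: DdP.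
rewrite -(partial_fstE (dt f)) /= => E2.
have E : ds (dt f) (s', t') = dt (ds f) (s, t).
  apply: (@mulIf _ (h ^+ 2)); first by rewrite expf_neq0// gt_eqF.
  apply: etrans (esym E2) _; apply: etrans _ E1.
  move: (f (x + h, y + h)) (f (x, y + h)) (f (x + h, y)) (f (x, y)) => *.
  by ring.
have w (z a b : R) : a < z < b -> a <= z <= b by move=> /andP[/ltW-> /ltW->].
have [_ [_ b2]] := bd _ (box _ _ (w _ _ _ xs) (w _ _ _ yt)).
have [_ [b1 _]] := bd _ (box _ _ (w _ _ _ xs') (w _ _ _ yt')).
exact: ler_dist_chain E b1 b2.
Qed.

End Schwarz.

(** * Differentiation under the integral sign *)

Section DerivativeOfIntegral.
Variable R : realType.

Lemma derive_integral_parameter (L : R * R -> R) (a b : R) :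
  (forall t, t \in `[a, b] -> \forall p \near (0, t),
     derivable L p (1, 0) /\ {for p, continuous L}) ->
  (forall t, t \in `[a, b] ->
     {for (0, t), continuous ('D_((1, 0) : R * R) L)}) ->
  is_derive (0 : R) (1 : R)
    (fun s => \int[lebesgue_measure]_(t in `[a, b]) L (s, t))
    (\int[lebesgue_measure]_(t in `[a, b]) 'D_((1, 0) : R * R) L (0, t)).
Proof.
move=> nL cDL.
(* By compactness of [[a, b]], the dominating bound and the range of the
   parameter can be chosen uniformly in [t]. *)
pose P (i : R * R) (t : R) := [/\ derivable L (i.1, t) (1, 0),
  {for (i.1, t), continuous L} & `|'D_((1, 0) : R * R) L (i.1, t)| <= i.2].
have : \forall i \near filter_prod (nbhs (0 : R)) (pinfty_nbhs R),
    `[a, b]%classic `<=` P i.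
  have cov := (compact_near_coveringP _).1 (@segment_compact R a b) _
    (filter_prod (nbhs (0 : R)) (pinfty_nbhs R)) P.
  apply: cov.
  move=> t /= tab.
  have := cDL t tab; rewrite /prop_for /continuous_at.
  move=> /cvgrPdist_lt/(_ 1 ltr01) n1.
  have [d /= d0 bd] := (nbhs_ballP _ _).1 (filterI (nL t tab) n1).
  pose M := `|'D_((1, 0) : R * R) L (0, t)| + 1.
  exists (ball t d, [set i : R * R | ball 0 d i.1 /\ M < i.2]).
    split; first exact: nbhsx_ballx.
    exists (ball 0 d, [set m : R | M < m]); last by move=> [s m] /= [].
    by split; [exact: nbhsx_ballx|apply: nbhs_pinfty_gt; exact: num_real].
  move=> [t' [s m]] /= [tt' [ss' Mm]].
  have [[dL cL] DL] := bd (s, t') (conj ss' tt').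
  split=> //; apply/ltW/(le_lt_trans _ Mm).
  by rewrite -lerBlDl (le_trans (lerB_dist _ _))// distrC ltW.
move=> [[A B] /= [A0 B0] AB].
have [d /= d0 dA] := (nbhs_ballP _ _).1 A0.
have [M BM] := filter_ex B0.
have key s t : s \in `]- d, d[ -> t \in `[a, b] ->
    [/\ derivable L (s, t) (1, 0),
      {for (s, t), continuous L} & `|'D_((1, 0) : R * R) L (s, t)| <= M].
  rewrite in_itv/= => sd tab; apply: (AB (s, M)) => //=.
  by split=> //=; apply: dA; rewrite /ball /= sub0r normrN ltr_norml.
pose f (s t : R) := L (s, t).
have I0 : `]- d, d[%classic (0 : R) by rewrite /= in_itv/= oppr_lt0 d0.
have intf x : `]- d, d[%classic x ->
    lebesgue_measure.-integrable `[a, b] (EFin \o f x).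
  move=> xd; apply: continuous_compact_integrable; first exact: segment_compact.
  apply/continuous_in_subspaceT => t; rewrite inE/= => tab.
  have [_ cL _] := key x t xd tab.
  exact: (@cvg_comp _ _ _ (fun t => (x, t)) L _ _ _
    (cvg_pair (cvg_cst _) cvg_id) cL).
have derf x y : `]- d, d[%classic x -> `[a, b]%classic y ->
    derivable (f ^~ y) x 1.
  by move=> xd yab; rewrite -derivable_partial_fst; have [] := key x y xd yab.
have ubf x y : `]- d, d[%classic x -> `[a, b]%classic y ->
    `|partial1of2 f x y| <= M.
  move=> xd yab; rewrite partial1of2E -partial_fstE.
  by have [] := key x y xd yab.
(* [M] is taken from a neighbourhood of infinity and has no known sign, while the dominating
   function must be nonnegative. *)
have M0 (y : R) : 0 <= `|M| by [].
have iM : lebesgue_measure.-integrable `[a, b] (EFin \o (fun _ => `|M|)).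
  apply: continuous_compact_integrable; first exact: segment_compact.
  by apply: continuous_subspaceT => x; exact: cst_continuous.
have ubf' x y : `]- d, d[%classic x -> `[a, b]%classic y ->
    `|partial1of2 f x y| <= `|M|.
  by move=> xd yab; rewrite (le_trans (ubf _ _ xd yab))// ler_norm.
apply: DeriveDef.
  exact: (@derivable_under_integral _ _ _ lebesgue_measure f `[a, b]%classic
    (measurable_itv _) _ _ _ I0 intf derf _ M0 iM ubf').
rewrite -derive1E.
rewrite (@differentiation_under_integral _ _ _ lebesgue_measure f `[a, b]%classic
    (measurable_itv _) _ _ _ I0 intf derf _ M0 iM ubf').
by apply: eq_Rintegral => t _; rewrite partial1of2E -partial_fstE.
Qed.

End DerivativeOfIntegral.

Section ScaleLinear.
Variables (R : realType) (W : normedModType R) (w : W).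

Definition scalel (k : R) : W := k *: w.

Lemma scalel_is_linear : linear scalel.
Proof. by move=> a x y; rewrite /scalel scalerDl scalerA. Qed.

HB.instance Definition _ :=
  GRing.isLinear.Build R R W *:%R scalel scalel_is_linear.

Lemma continuous_scalel : continuous scalel.
Proof. exact: scalel_continuous. Qed.

Lemma is_derive_scalel (V : normedModType R) (f : V -> R) x v df :
  is_derive x v f df -> is_derive x v (fun y => f y *: w) (df *: w).
Proof. exact: is_derive_linear continuous_scalel. Qed.

End ScaleLinear.

(** * Derivatives of curves constrained on a closed segment *)

Section OneSidedDerivatives.
Variable R : realType.

(** At an endpoint the functions agree on one side only; since both two-sided derivatives exist,
    they equal the limits of the difference quotients from inside the segment. *)
Lemma eq_derive_segment (W : normedModType R) (f g : R -> W) (a b t : R) :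
  a < b -> t \in `[a, b] -> (forall u, u \in `[a, b] -> f u = g u) ->
  derivable f t 1 -> derivable g t 1 -> 'D_1 f t = 'D_1 g t.
Proof.
move=> ab; rewrite in_itv/= => /andP[ta tb] fg fd gd.
pose qf k (h : R) : W := h^-1 *: ((k \o shift t) (h *: 1) - k t).
have E h : a <= h + t <= b -> qf f h = qf g h.
  move=> th; rewrite /qf /= [h *: 1]mulr1 !fg// in_itv//=; exact/andP.
have lim_eq (F : set_system R) : Filter F ->
    (\forall h \near F, a <= h + t <= b) ->
    lim (qf f @ F) = lim (qf g @ F).
  move=> FF n0; congr (lim _); rewrite eqEsubset.
  by split; apply: near_eq_cvg; apply: filterS n0 => h /E.
rewrite -[LHS]/(lim (qf f @ 0^')) -[RHS]/(lim (qf g @ 0^')).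
have [tb'|bt] := ltP t b.
  rewrite (@cvg_at_rightE _ _ (qf f) 0 fd) (@cvg_at_rightE _ _ (qf g) 0 gd).
  apply: lim_eq.
  near=> h.
  have h0 : 0 < h by [].
  have hb : h < b - t by near: h; apply: nbhs_right_lt; rewrite subr_gt0.
  by apply/andP; split; lra.
rewrite (@cvg_at_leftE _ _ (qf f) 0 fd) (@cvg_at_leftE _ _ (qf g) 0 gd).
  apply: lim_eq.
near=> h.
have h0 : h < 0 by [].
have ha : a - t < h by near: h; apply: nbhs_left_gt; rewrite subr_lt0; lra.
by apply/andP; split; lra.
Unshelve. all: by end_near. Qed.

(** The constants [<c, c> = - r^2] and [<c, e> = 0] are differentiated, endpoints included. This
    serves for the profile curve and, in the parameter [s], for the variation field. *)
Lemma curve_orth (r : R) (P3 : {vspace 'rV[R]_4}) (c : R -> 'rV[R]_4)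
    (e : 'rV[R]_4) (a b t : R) :
  a < b -> t \in `[a, b] -> derivable c t 1 ->
  (forall u, u \in `[a, b] -> hyperbolic_plane r P3 (c u)) ->
  (forall p, p \in P3 -> lorentz p e = 0) ->
  lorentz ('D_1 c t) (c t) = 0 /\ lorentz ('D_1 c t) e = 0.
Proof.
move=> ab tab dc cP Pe; have dc' := derivableP dc; split.
  have d1 := is_derive_lorentz dc' dc'.
  have E u : u \in `[a, b] -> lorentz (c u) (c u) = cst (- r ^+ 2) u.
    by move=> /cP[_ []].
  have := eq_derive_segment ab tab E (ex_derive (is_derive := d1))
    (derivable_cst _ _ _).
  rewrite (derive_val (is_derive := d1)) derive_cst (lorentzC (c t)).
  by move/eqP; rewrite -mulr2n mulrn_eq0/= => /eqP.
have d1 := is_derive_linear (@continuous_lorentzr R e) dc'.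
have E u : u \in `[a, b] -> (lorentzr e \o c) u = cst 0 u.
  by move=> /cP[u3 _]; exact: Pe.
have := eq_derive_segment ab tab E (ex_derive (is_derive := d1))
  (derivable_cst _ _ _).
by rewrite (derive_val (is_derive := d1)) derive_cst.
Qed.

End OneSidedDerivatives.

(** * The minimal surface equation on the profile curve *)

(* [cayley_sin] and [cayley_cos] are the coefficients [a] and [b] of [rot_mx];
   for [c > 0] and [c y^2 = tan^2 (theta / 2)] they are
   [sin theta / sqrt c] and [(1 - cos theta) / c]. *)
Section RotationCoefficients.
Variables (R : realType) (c : R).

Definition cayley_inv (y : R) := (1 + c * y ^+ 2)^-1.
Definition cayley_sin (y : R) := 2 * y * cayley_inv y.
Definition cayley_cos (y : R) := y * cayley_sin y.
Definition cayley_sin' (y : R) := 2 * (1 - c * y ^+ 2) * cayley_inv y ^+ 2.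
Definition cayley_cos' (y : R) := 4 * y * cayley_inv y ^+ 2.

Variable y : R.
Hypothesis y0 : 1 + c * y ^+ 2 != 0.

Lemma is_derive_cayley_inv :
  is_derive y 1 cayley_inv (- (2 * c * y * cayley_inv y ^+ 2)).
Proof.
have dD : is_derive y 1 (fun y => 1 + c * y ^+ 2) (2 * c * y).
  apply: is_derive_eq (is_deriveD (is_derive_cst (1 : R) y 1)
    (is_deriveM (is_derive_cst c y 1) (is_deriveX 2 (is_derive_id y 1)))) _.
  by rewrite /GRing.scale /=; ring.
apply: DeriveDef; first exact: derivableV.
rewrite deriveV//.
by case: dD => _ ->; rewrite /GRing.scale /= /cayley_inv exprVn; ring.
Qed.

Lemma is_derive_cayley_sin : is_derive y 1 cayley_sin (cayley_sin' y).
Proof.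
apply: is_derive_eq (is_deriveM (is_deriveM (is_derive_cst (2 : R) y 1)
  (is_derive_id y 1)) is_derive_cayley_inv) _.
by rewrite /GRing.scale /= ?fctE /= /cayley_sin' /cayley_inv; field.
Qed.

Lemma is_derive_cayley_cos : is_derive y 1 cayley_cos (cayley_cos' y).
Proof.
apply: is_derive_eq (is_deriveM (is_derive_id y 1) is_derive_cayley_sin) _.
rewrite /GRing.scale /= ?fctE /= /cayley_sin' /cayley_cos' /cayley_sin.
by rewrite /cayley_inv; field.
Qed.

Lemma derivable_cayley_sin' : derivable cayley_sin' y 1.
Proof.
by case: (is_deriveM (is_deriveM (is_derive_cst (2 : R) y 1)
  (is_deriveB (is_derive_cst (1 : R) y 1) (is_deriveM (is_derive_cst c y 1)
  (is_deriveX 2 (is_derive_id y 1))))) (is_deriveX 2 is_derive_cayley_inv)).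
Qed.

Lemma cayley_sinE : cayley_sin y * (1 + c * y ^+ 2) = 2 * y.
Proof. by rewrite /cayley_sin /cayley_inv divfK. Qed.

Lemma cayley_sqr : cayley_sin y ^+ 2 + c * cayley_cos y ^+ 2 = 2 * cayley_cos y.
Proof. by rewrite /cayley_cos /cayley_sin /cayley_inv; field. Qed.

(** Half the derivative of [cayley_sqr]. *)
Lemma cayley_sqr_derive :
  cayley_sin y * cayley_sin' y + c * (cayley_cos y * cayley_cos' y) =
  cayley_cos' y.
Proof.
by rewrite /cayley_cos /cayley_cos' /cayley_sin /cayley_sin' /cayley_inv; field.
Qed.

Lemma cayley_speed :
  cayley_sin' y ^+ 2 + c * cayley_cos' y ^+ 2 = 4 * cayley_inv y ^+ 2.
Proof.
by rewrite /cayley_cos' /cayley_sin' /cayley_inv; field.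
Qed.

End RotationCoefficients.

(** For [c >= 0] this is the whole line; for [c < 0], when [nu] is timelike, it is the interval
    between the two poles of the Cayley coefficients. *)
Lemma open_cayley_domain (R : realType) (c : R) :
  open [set y : R | 0 < 1 + c * y ^+ 2].
Proof.
apply: (@open_comp _ _ (fun y : R => 1 + c * y ^+ 2) [set y | 0 < y]).
  move=> y _; apply: cvgD; first exact: cvg_cst.
  by apply: cvgM; [exact: cvg_cst|exact: exprn_continuous].
exact: open_gt.
Qed.

Lemma near0_cayley_domain (R : realType) (c : R) :
  \forall y \near (0 : R), 0 < 1 + c * y ^+ 2.
Proof.
apply: open_nbhs_nbhs; split; first exact: open_cayley_domain.
by rewrite /= expr0n mulr0 addr0.
Qed.

Lemma is_derive_cayley_cos'0 (R : realType) (c : R) :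
  is_derive (0 : R) (1 : R) (cayley_cos' c) (4 : R).
Proof.
have n0 : 1 + c * 0 ^+ 2 != 0 by rewrite expr0n mulr0 addr0 oner_neq0.
apply: is_derive_eq (is_deriveM (is_deriveM (is_derive_cst (4 : R) (0 : R) (1 : R))
  (is_derive_id (0 : R) (1 : R))) (is_deriveX 2 (is_derive_cayley_inv n0))) _.
rewrite /GRing.scale /= ?fctE /= /cayley_inv expr0n /= !mulr0 addr0 invr1.
by ring.
Qed.

Lemma free_orthogonal (R : realType) (x y : 'rV[R]_4) :
  lorentz x y = 0 -> lorentz x x != 0 -> lorentz y y != 0 -> free [:: x; y].
Proof.
move=> xy xx yy; rewrite free_cons seq1_free span_seq1; apply/andP; split.
  apply/negP => /vlineP[k xE]; move: xx; rewrite {1}xE lorentzZl (lorentzC y).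
  by rewrite xy mulr0 eqxx.
by apply: contraNneq yy => ->; rewrite lorentz0l.
Qed.

(** Division by zero gives 0, so a vanishing quotient is informative only once its denominator
    [2 E G] is known to be nonzero. *)
Lemma mean_curvature_orthogonal (R : realType) (r : R) (X : R * R -> 'rV[R]_4)
    (p : R * R) (N : 'rV[R]_4) (E G : R) :
  lorentz ('D_(1, 0) X p) ('D_(1, 0) X p) = E ->
  lorentz ('D_(1, 0) X p) ('D_(0, 1) X p) = 0 ->
  lorentz ('D_(0, 1) X p) ('D_(0, 1) X p) = G ->
  E != 0 -> G != 0 -> mean_curvature r X p N = 0 ->
  second_form r X p N (1, 0) (1, 0) * G + second_form r X p N (0, 1) (0, 1) * E
  = 0.
Proof.
have scalar (E1 F1 G1 e f g : R) : E1 = E -> F1 = 0 -> G1 = G ->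
    E != 0 -> G != 0 ->
    (e * G1 - 2 * f * F1 + g * E1) / (2 * (E1 * G1 - F1 ^+ 2)) = 0 ->
    e * G + g * E = 0.
  move=> -> -> -> E0 G0 /eqP.
  rewrite mulr0 subr0 expr0n /= subr0 mulf_eq0 invr_eq0 !mulf_eq0 pnatr_eq0 /=.
  by rewrite (negPf E0) (negPf G0) !orbF => /eqP.
exact: scalar.
Qed.

(** * The patch obtained by rotating the curve over an open interval *)

Section RotatedCurve.
Variables (R : realType) (r : R) (P2 P3 : {vspace 'rV[R]_4}).
Variables (a b : R) (gamma : R -> 'rV[R]_4) (nu e : 'rV[R]_4) (A : set R).
Hypotheses (r0 : 0 < r) (P23 : (P2 <= P3)%VS).
Hypothesis oA : open A.
Hypothesis abA : `]a, b[ `<=` A.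
Hypothesis gamma_smooth : forall vs (x : R), A x ->
  differentiable (foldr (fun v g => 'D_v g) gamma vs) x.
Hypothesis gammaP : forall t, t \in `]a, b[ -> hyperbolic_plane r P3 (gamma t).
Hypothesis gamma'0 : forall t, t \in `]a, b[ -> 'D_1 gamma t != 0.
Hypothesis nuP : conormal P2 P3 nu.
Hypothesis ee : lorentz e e = 1.
Hypothesis Pe : forall p, p \in P3 -> lorentz p e = 0.
Hypothesis height0 : forall t, t \in `]a, b[ -> lorentz (gamma t) nu != 0.

Let c := lorentz nu nu.
Let h t := lorentz (gamma t) nu.
Let gamma' := 'D_1 gamma.
Let h' t := lorentz (gamma' t) nu.

Let nue : lorentz nu e = 0.
Proof. by case: nuP => nu3 _ _; exact: Pe. Qed.

(** The orbit map with [<gamma, e> = 0] already used: apart from [gamma], only scalar functions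
    times fixed vectors have to be differentiated. *)
Definition rotated_curve (p : R * R) : 'rV[R]_4 :=
  gamma p.1 + (cayley_sin c p.2 * h p.1) *: e
            + (- cayley_cos c p.2 * h p.1) *: nu.

Let U : set (R * R) := [set p | (p.1 \in `]a, b[) /\ (0 < 1 + c * p.2 ^+ 2)].

Lemma rotated_curveE p : p.1 \in `]a, b[ -> rotated_curve p =
  gamma p.1 *m rot_mx nu e (cayley_sin c p.2) (cayley_cos c p.2).
Proof.
move=> pab; have [g3 _] := gammaP pab.
by rewrite /rotated_curve rot_mxE// Pe// !mulr0 subr0 add0r mulNr scaleNr.
Qed.

Lemma rot_in_group y : 0 < 1 + c * y ^+ 2 ->
  revolution_group r P2 (rot_mx nu e (cayley_sin c y) (cayley_cos c y)).
Proof.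
move=> y0; apply: (rot_mx_revolution_group r0 nue ee _ y0) => //.
- move=> p p2; split; last by apply: Pe; exact: (subvP P23).
  by case: nuP => _ _ H; rewrite lorentzC H.
- by rewrite cayley_sinE// gt_eqF.
Qed.

Lemma gamma_is_derive t : t \in `]a, b[ -> is_derive t 1 gamma (gamma' t).
Proof.
move=> tab; apply/derivableP/diff_derivable.
exact: (gamma_smooth [::] (abA tab)).
Qed.

Lemma h_is_derive t : t \in `]a, b[ -> is_derive t 1 h (h' t).
Proof.
move=> tab.
exact: (is_derive_linear (@continuous_lorentzr R nu) (gamma_is_derive tab)).
Qed.

Lemma gamma_orth t : t \in `]a, b[ ->
  lorentz (gamma' t) (gamma t) = 0 /\ lorentz (gamma' t) e = 0.
Proof.
(* [curve_orth] wants a closed segment: [t] is the left end of one inside the open interval. *)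
move=> tab; have tb : t < (t + b) / 2 by move: tab; rewrite in_itv/=; lra.
apply: (curve_orth tb _ _ _ Pe); first by rewrite in_itv/= lexx ltW.
  by case: (gamma_is_derive tab).
by move=> u ut; apply: gammaP; move: tab ut; rewrite !in_itv/=; lra.
Qed.

Lemma gamma'_spacelike t : t \in `]a, b[ -> 0 < lorentz (gamma' t) (gamma' t).
Proof.
move=> tab; have [_ [gg _]] := gammaP tab.
apply: (@orth_timelike_spacelike _ (gamma t)); last exact: gamma'0.
  by rewrite gg oppr_lt0 exprn_gt0.
by case: (gamma_orth tab).
Qed.

Lemma rotated_curve_s s y : s \in `]a, b[ ->
  is_derive s 1 (fun s => rotated_curve (s, y))
    (gamma' s + (cayley_sin c y * h' s) *: e + (- cayley_cos c y * h' s) *: nu).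
Proof.
move=> sab; have dh := h_is_derive sab.
have dk (k : R) (w : 'rV[R]_4) :
    is_derive s 1 (fun s => (k * h s) *: w) ((k * h' s) *: w).
  exact: is_derive_scalel.
exact: is_deriveD (is_deriveD (gamma_is_derive sab) (dk (cayley_sin c y) e))
  (dk (- cayley_cos c y) nu).
Qed.

Lemma rotated_curve_y s y : 1 + c * y ^+ 2 != 0 ->
  is_derive y 1 (fun y => rotated_curve (s, y))
    ((cayley_sin' c y * h s) *: e + (- cayley_cos' c y * h s) *: nu).
Proof.
move=> y0.
have d1 : is_derive y 1 (fun y => (cayley_sin c y * h s) *: e)
    ((cayley_sin' c y * h s) *: e).
  apply: is_derive_scalel.
  apply: is_derive_eq (is_deriveM (is_derive_cayley_sin y0)
    (is_derive_cst (h s) y 1)) _.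
  by rewrite /GRing.scale /= mulr0 add0r mulrC.
have d2 : is_derive y 1 (fun y => (- cayley_cos c y * h s) *: nu)
    ((- cayley_cos' c y * h s) *: nu).
  apply: is_derive_scalel.
  apply: is_derive_eq (is_deriveM (is_deriveN (is_derive_cayley_cos y0))
    (is_derive_cst (h s) y 1)) _.
  by rewrite /GRing.scale /= mulr0 add0r mulrC.
apply: is_derive_eq (is_deriveD
  (is_deriveD (is_derive_cst (gamma s) y 1) d1) d2) _.
by rewrite add0r.
Qed.

Lemma rotated_curve_partial_s s y : s \in `]a, b[ ->
  'D_(1, 0) rotated_curve (s, y) =
    gamma' s + (cayley_sin c y * h' s) *: e + (- cayley_cos c y * h' s) *: nu.
Proof. by move=> sab; rewrite partial_fstE; have [] := rotated_curve_s y sab. Qed.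

Lemma rotated_curve_partial_y s y : 1 + c * y ^+ 2 != 0 ->
  'D_(0, 1) rotated_curve (s, y) =
    (cayley_sin' c y * h s) *: e + (- cayley_cos' c y * h s) *: nu.
Proof. by move=> y0; rewrite partial_sndE; have [] := rotated_curve_y s y0. Qed.

(** Each entry rests on one Cayley identity: [cayley_sqr] cancels the [h'^2] term of E,
    [cayley_sqr_derive] the [h h'] term of F, and [cayley_speed] is the factor of [h^2] in G. *)
Lemma rotated_curve_metric s y : s \in `]a, b[ -> 1 + c * y ^+ 2 != 0 ->
  let Xs := 'D_(1, 0) rotated_curve (s, y) in
  let Xy := 'D_(0, 1) rotated_curve (s, y) in
  [/\ lorentz Xs Xs = lorentz (gamma' s) (gamma' s), lorentz Xs Xy = 0 &
      lorentz Xy Xy = 4 * cayley_inv c y ^+ 2 * h s ^+ 2].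
Proof.
move=> sab y0 Xs Xy; have [_ ge] := gamma_orth sab; rewrite /Xs /Xy {Xs Xy}.
rewrite rotated_curve_partial_s// rotated_curve_partial_y//.
have en := etrans (lorentzC e nu) nue.
have eg := etrans (lorentzC e _) ge.
have ng : lorentz nu (gamma' s) = h' s by rewrite lorentzC.
have gn : lorentz (gamma' s) nu = h' s by [].
have E1 := cayley_sqr y0; have E2 := cayley_sqr_derive y0.
have E3 := cayley_speed y0.
rewrite !lorentzL nue en ee eg ge ng gn -/c.
move: (lorentz (gamma' s) (gamma' s)) (h' s) (h s) => E k l.
split.
- transitivity (E + k ^+ 2 * (cayley_sin c y ^+ 2 + c * cayley_cos c y ^+ 2
    - 2 * cayley_cos c y)); first by ring.
  by rewrite E1 subrr mulr0 addr0.
- transitivity (k * l * (cayley_sin c y * cayley_sin' c y +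
    c * (cayley_cos c y * cayley_cos' c y) - cayley_cos' c y)); first by ring.
  by rewrite E2 subrr mulr0.
- by rewrite -E3; ring.
Qed.

Let open_U : open U.
Proof.
apply: openI.
  apply: (@open_comp _ _ fst `]a, b[%classic); last exact: interval_open.
  by move=> p _; exact: cvg_fst.
apply: (@open_comp _ _ snd [set y | 0 < 1 + c * y ^+ 2]).
  by move=> p _; exact: cvg_snd.
exact: open_cayley_domain.
Qed.

Lemma rotated_curve_smooth : smooth_on U rotated_curve.
Proof.
apply: diff_upto_smooth => // n.
have U0 p : U p -> 1 + c * p.2 ^+ 2 != 0 by move=> [_ /gt_eqF/negbT].
have cfst : continuous (fst : (R * R)%type -> R) by move=> p; exact: cvg_fst.
have csnd : continuous (snd : (R * R)%type -> R) by move=> p; exact: cvg_snd.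
have Dg : diff_upto U n (gamma \o fst).
  apply: (@diff_upto_comp_linear _ _ _ _ _ _ A) => //.
  by move=> p [pab _]; exact: abA.
have Dh : diff_upto U n (fun p => h p.1).
  exact: (diff_upto_linear open_U (@continuous_lorentzr R nu) Dg).
have Dy : diff_upto U n (snd : (R * R)%type -> R).
  exact: diff_upto_linear_fun.
have Dc (k : R) : diff_upto U n (fun=> k) by exact: diff_upto_cst.
have Ds : diff_upto U n (fun p => cayley_sin c p.2).
  apply: (diff_uptoM open_U (diff_uptoM open_U (Dc 2) Dy)).
  apply: diff_uptoV => //; apply: diff_uptoD => //.
  by apply: (diff_uptoM open_U (Dc c)); exact: diff_uptoM.
have Dcos : diff_upto U n (fun p => - cayley_cos c p.2).
  have := diff_uptoM open_U (Dc (-1)) (diff_uptoM open_U Dy Ds).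
  by apply: eq_diff_upto => // p _; rewrite mulN1r.
have Dw (k : R * R -> R) (w : 'rV[R]_4) : diff_upto U n k ->
    diff_upto U n (fun p => k p *: w).
  exact: (diff_upto_linear open_U (@continuous_scalel _ _ w)).
by apply: (diff_uptoD open_U (diff_uptoD open_U Dg _)); apply: Dw;
  exact: diff_uptoM.
Qed.

Lemma rotated_curve_patch : immersed_patch r U rotated_curve.
Proof.
split=> //; first exact: rotated_curve_smooth.
  move=> p [pab y0]; rewrite rotated_curveE//.
  have [_ _ _ H] := rot_in_group y0.
  by apply: H; have [] := gammaP pab.
move=> [s y] [/= sab y0].
have yn0 : 1 + c * y ^+ 2 != 0 by rewrite gt_eqF.
have [E F G] := rotated_curve_metric sab yn0.
apply: free_orthogonal; first exact: F.
  by rewrite E; apply: lt0r_neq0; exact: gamma'_spacelike.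
by rewrite G !mulf_neq0 ?expf_neq0 ?invr_eq0 ?pnatr_eq0 ?height0.
Qed.

(** At [y = 0] the metric is [E = |gamma'|^2], [F = 0], [G = 4 h^2], and the second form has
    diagonal entries [<gamma'', n>] and [- 4 h <nu, n>]. Vanishing mean curvature, divided by [4 h],
    is the claim. *)
Lemma minimal_profile_equation (I : set R) n t :
  minimal_surface r (surface_of_revolution r P2 I gamma) ->
  `]a, b[ `<=` I -> t \in `]a, b[ ->
  lorentz n (gamma t) = 0 -> lorentz n (gamma' t) = 0 -> lorentz n e = 0 ->
  lorentz n n = 1 ->
  lorentz (gamma t) nu * lorentz ('D_1 ('D_1 gamma) t) n =
  lorentz nu n * lorentz ('D_1 gamma t) ('D_1 gamma t).
Proof.
move=> hmin abI tab ng ng' ne nn.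
have z0 : 0 < 1 + c * 0 ^+ 2 by rewrite expr0n mulr0 addr0.
have zn0 : 1 + c * 0 ^+ 2 != 0 by rewrite gt_eqF.
have Up : U (t, 0) by [].
have sub : rotated_curve @` U `<=` surface_of_revolution r P2 I gamma.
  move=> _ [p [pab y0] <-].
  exists p.1, (rot_mx nu e (cayley_sin c p.2) (cayley_cos c p.2)).
  by split; [exact: abI|exact: rot_in_group|exact: rotated_curveE].
have s0 : cayley_sin c 0 = 0 by rewrite /cayley_sin mulr0 mul0r.
have c0 : cayley_cos c 0 = 0 by rewrite /cayley_cos mul0r.
have Xs0 s : rotated_curve (s, 0) = gamma s.
  by rewrite /rotated_curve /= s0 c0 oppr0 !mul0r !scale0r !addr0.
have Xs : 'D_(1, 0) rotated_curve (t, 0) = gamma' t.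
  by rewrite partial_fstE; congr ('D_1 _ t); apply/funext => s.
have cs'0 : cayley_sin' c 0 = 2.
  rewrite /cayley_sin' /cayley_inv expr0n /= mulr0 subr0 addr0 invr1 expr1n.
  by rewrite !mulr1.
have cc'0 : cayley_cos' c 0 = 0 by rewrite /cayley_cos' mulr0 mul0r.
have Xy : 'D_(0, 1) rotated_curve (t, 0) = (2 * h t) *: e.
  by rewrite rotated_curve_partial_y// cs'0 cc'0 oppr0 mul0r scale0r addr0.
have Xss : 'D_(1, 0) ('D_(1, 0) rotated_curve) (t, 0) = 'D_1 gamma' t.
  rewrite partial_fstE; congr ('D_1 _ t); apply/funext => s.
  by rewrite partial_fstE; congr ('D_1 _ s); apply/funext => s'.
have Xyy : lorentz ('D_(0, 1) ('D_(0, 1) rotated_curve) (t, 0)) n =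
    - (4 * h t) * lorentz nu n.
  rewrite partial_sndE.
  (* The formula for the first partial derivative holds where [1 + c y^2] is nonzero, so it is
     differentiated again as a germ at 0. *)
  have near0 : {near 0, (fun y => (cayley_sin' c y * h t) *: e +
      (- cayley_cos' c y * h t) *: nu) =1
      (fun y => 'D_(0, 1) rotated_curve (t, y))}.
    apply: filterS (near0_cayley_domain c) => y y0.
    exact/esym/rotated_curve_partial_y/lt0r_neq0.
  rewrite -(near_eq_derive _ near0).
  (* The value of this second derivative does not matter: it multiplies [e], to which [n] is
     orthogonal. *)
  have ds := is_derive_scalel e (is_deriveM
    (derivableP (derivable_cayley_sin' zn0))
    (is_derive_cst (h t) (0 : R) (1 : R))).
  have dc := is_derive_scalel nu (is_deriveM
    (is_deriveN (is_derive_cayley_cos'0 c))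
    (is_derive_cst (h t) (0 : R) (1 : R))).
  have [_ ->] := is_deriveD ds dc.
  rewrite lorentzDl !lorentzZl (lorentzC e n) ne mulr0 add0r /GRing.scale /=.
  by rewrite mulr0 add0r mulrN (mulrC (h t)).
have un : unit_normal rotated_curve (t, 0) n.
  by split; rewrite ?Xs0 ?Xs ?Xy ?lorentzZr ?ne ?mulr0.
have H0 := hmin _ _ rotated_curve_patch sub _ _ Up un.
have [E F G] := rotated_curve_metric tab zn0.
have E0 := lt0r_neq0 (gamma'_spacelike tab).
have h0 : h t != 0 by exact: height0.
have v0 : cayley_inv c 0 = 1 by rewrite /cayley_inv expr0n /= mulr0 addr0 invr1.
rewrite v0 expr1n mulr1 in G.
have G0 : 4 * h t ^+ 2 != 0 by rewrite mulf_neq0 ?pnatr_eq0 ?expf_neq0.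
have := mean_curvature_orthogonal E F G E0 G0 H0.
have -> : second_form r rotated_curve (t, 0) n (1, 0) (1, 0) =
    lorentz ('D_1 gamma' t) n.
  rewrite /second_form /tangent_part Xss Xs0 lorentzDl lorentzZl.
  by rewrite (lorentzC (gamma t)) ng mulr0 addr0.
have -> : second_form r rotated_curve (t, 0) n (0, 1) (0, 1) =
    - (4 * h t) * lorentz nu n.
  rewrite /second_form /tangent_part Xs0 lorentzDl lorentzZl.
  by rewrite (lorentzC (gamma t)) ng mulr0 addr0.
rewrite -/gamma' -/(h t).
move: (lorentz (gamma' t) (gamma' t)) (h t) (lorentz _ n) (lorentz nu n) h0.
move=> E1 k g'' m k0 eq0.
apply: (@mulfI _ (4 * k)); first by rewrite mulf_neq0 ?pnatr_eq0.
by apply/eqP; rewrite -subr_eq0 -eq0; apply/eqP; ring.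
Qed.

End RotatedCurve.

(** * The first variation *)

Section VariationCalculus.
Variable R : realType.

Lemma is_derive_sqrt_weight (h q : R -> R) (x dh dq : R) :
  is_derive x 1 h dh -> is_derive x 1 q dq -> 0 < h x ^+ 2 * q x ->
  is_derive x 1 (fun y => Num.sqrt (h y ^+ 2 * q y))
    ((2 * h x * dh * q x + h x ^+ 2 * dq) / (2 * Num.sqrt (h x ^+ 2 * q x))).
Proof.
move=> hd qd Q0.
have Qd : is_derive x 1 (fun y => h y ^+ 2 * q y)
    (2 * h x * dh * q x + h x ^+ 2 * dq).
  apply: is_derive_eq (is_deriveM (is_deriveX 2 hd) qd) _.
  by rewrite /GRing.scale /= ?fctE; ring.
have := @is_derive1_comp _ Num.sqrt (fun y => h y ^+ 2 * q y) x _ _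
  (is_derive1_sqrt Q0) Qd.
by rewrite /GRing.scale /= mulrC.
Qed.

Lemma is_derive_momentum (h k q : R -> R) (x dh dk dq : R)
    (S := Num.sqrt (h x ^+ 2 * q x)) :
  is_derive x 1 h dh -> is_derive x 1 k dk -> is_derive x 1 q dq ->
  0 < h x ^+ 2 * q x ->
  is_derive x 1 (fun y => h y ^+ 2 * k y / Num.sqrt (h y ^+ 2 * q y))
    ((2 * h x * dh * k x + h x ^+ 2 * dk) / S
     - h x ^+ 2 * k x * ((2 * h x * dh * q x + h x ^+ 2 * dq) / (2 * S))
       / S ^+ 2).
Proof.
move=> hd kd qd Q0; have S0 : S != 0 by rewrite gt_eqF// sqrtr_gt0.
have [D DE] := is_derive_sqrt_weight hd qd Q0.
have dV : is_derive x 1 (fun y => (Num.sqrt (h y ^+ 2 * q y))^-1)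
    (- S ^- 2 * ((2 * h x * dh * q x + h x ^+ 2 * dq) / (2 * S))).
  by apply: DeriveDef; [exact: derivableV|rewrite deriveV// DE].
apply: is_derive_eq (is_deriveM (is_deriveM (is_deriveX 2 hd) kd) dV) _.
by rewrite /GRing.scale /= ?fctE -/S; field.
Qed.

(* With h = <gamma, nu>, q = <gamma', gamma'> and k = <W, gamma'>, the left side
   is the derivative of h^2 k / sqrt (h^2 q) and the right side the variation of
   sqrt (h^2 q); [wn] and [wp] are <W, nu> and <W, gamma''> expanded for
   W = (k / q) gamma' + m N, and [h * l = n * q] is minimality. *)
Lemma momentum_identity (h h' q k k1 k2 l m n p wn wp S : R) :
  h * l = n * q -> q != 0 -> S != 0 -> S ^+ 2 = h ^+ 2 * q ->
  wn = k / q * h' + m * n -> wp = k / q * p + m * l -> k1 = k2 ->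
  (2 * h * h' * k + h ^+ 2 * (k1 + wp)) / S
    - h ^+ 2 * k * ((2 * h * h' * q + h ^+ 2 * (2 * p)) / (2 * S)) / S ^+ 2 =
  (2 * h * wn * q + h ^+ 2 * (2 * k2)) / (2 * S).
Proof.
move=> hl q0 S0 S2 -> -> ->; rewrite S2.
have h0 : h != 0.
  by apply: contraNneq S0 => h0; rewrite -sqrf_eq0 S2 h0 expr0n mul0r.
apply/eqP; rewrite -subr_eq0; apply/eqP.
transitivity (h * m * (h * l - n * q) / S); first by field; rewrite q0 h0 S0.
by rewrite hl subrr mulr0 mul0r.
Qed.

Lemma near_eq_continuous (T : topologicalType) (S : topologicalType)
    (f g : T -> S) x :
  {near x, f =1 g} -> {for x, continuous f} -> {for x, continuous g}.
Proof.
move=> fg; rewrite /prop_for /continuous_at (nbhs_singleton fg).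
by move=> cf; apply: cvg_trans cf; exact: near_eq_cvg.
Qed.

(** The mean value theorem behind [schwarz] is scalar, so [F] is paired with a fixed vector, which
    commutes with both derivatives. *)
Lemma schwarz_lorentz (F : R * R -> 'rV[R]_4) (U : set (R * R)) p w :
  open U -> U p -> (forall n, diff_upto U n F) ->
  lorentz ('D_(1, 0) ('D_(0, 1) F) p) w = lorentz ('D_(0, 1) ('D_(1, 0) F) p) w.
Proof.
move=> oU Up FU; pose f := lorentzr w \o F.
have fU n : diff_upto U n f.
  exact: (diff_upto_linear oU (@continuous_lorentzr R w)).
have D1 v q : U q -> 'D_v f q = lorentz ('D_v F q) w.
  move=> Uq; have dF := derivableP (diff_derivable (v := v) (diff_upto0 (FU 0%N) Uq)).
  by have [_ ->] := is_derive_linear (@continuous_lorentzr R w) dF.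
have D2 u v : 'D_u ('D_v f) p = lorentz ('D_u ('D_v F) p) w.
  have dF := derivableP (diff_derivable (v := u) (FU 1%N [:: v] isT p Up)).
  have [_ H] := is_derive_linear (@continuous_lorentzr R w) dF.
  apply: etrans H.
  by apply: near_eq_derive; apply: (near_open oU) => // q; exact: D1.
apply: etrans (esym (D2 _ _)) _; apply: etrans _ (D2 _ _).
apply: (schwarz oU Up).
- by move=> q; exact: (fU 0%N [::]).
- by move=> v q; exact: (fU 1%N [:: v]).
- exact/differentiable_continuous/(fU 2%N [:: _; _]).
- exact/differentiable_continuous/(fU 2%N [:: _; _]).
Qed.

Section SmoothFunctions.
Variables (V W : normedModType R) (U : set V) (F : V -> W).
Hypothesis FU : forall n, diff_upto U n F.

Lemma smooth_derive v n : diff_upto U n ('D_v F).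
Proof. by have [_] := (@diff_uptoS _ _ U _ n F).1 (@FU n.+1). Qed.

Lemma smooth_is_derive p v : U p -> is_derive p v F ('D_v F p).
Proof. by move=> Up; exact/derivableP/diff_derivable/(diff_upto0 (@FU 0%N)). Qed.

Lemma smooth_continuous p : U p -> {for p, continuous F}.
Proof. by move=> Up; exact/differentiable_continuous/(diff_upto0 (@FU 0%N)). Qed.

End SmoothFunctions.

Lemma smooth_is_derive_fst (W : normedModType R) (U : set (R * R))
    (F : R * R -> W) s t : (forall n, diff_upto U n F) -> U (s, t) ->
  is_derive s 1 (fun s => F (s, t)) ('D_(1, 0) F (s, t)).
Proof.
move=> FU /(smooth_is_derive FU (1, 0)) [D _].
apply: DeriveDef; first by rewrite -derivable_partial_fst.
by rewrite partial_fstE.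
Qed.

Lemma smooth_is_derive_snd (W : normedModType R) (U : set (R * R))
    (F : R * R -> W) s t : (forall n, diff_upto U n F) -> U (s, t) ->
  is_derive t 1 (fun t => F (s, t)) ('D_(0, 1) F (s, t)).
Proof.
move=> FU /(smooth_is_derive FU (0, 1)) [D _].
apply: DeriveDef; first by rewrite -derivable_partial_snd.
by rewrite partial_sndE.
Qed.

End VariationCalculus.

(** * Vanishing of the first variation on a segment *)

Section FirstVariation.
Variables (R : realType) (r : R) (P3 : {vspace 'rV[R]_4}) (a b : R).
Variables (gamma : R -> 'rV[R]_4) (nu e : 'rV[R]_4) (A : set R).
Hypotheses (r0 : 0 < r) (ab : a < b).
Hypothesis abA : `[a, b] `<=` A.
Hypothesis gamma_smooth : forall n, diff_upto A n gamma.
Hypothesis gammaP : forall t, t \in `[a, b] -> hyperbolic_plane r P3 (gamma t).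
Hypothesis gamma'0 : forall t, t \in `[a, b] -> 'D_1 gamma t != 0.
Hypothesis ee : lorentz e e = 1.
Hypothesis Pe : forall p, p \in P3 -> lorentz p e = 0.
Hypothesis height0 : forall t, t \in `[a, b] -> lorentz (gamma t) nu != 0.
Hypothesis profile_equation : forall n t, t \in `]a, b[ ->
  lorentz n (gamma t) = 0 -> lorentz n ('D_1 gamma t) = 0 -> lorentz n e = 0 ->
  lorentz n n = 1 ->
  lorentz (gamma t) nu * lorentz ('D_1 ('D_1 gamma) t) n =
  lorentz nu n * lorentz ('D_1 gamma t) ('D_1 gamma t).

Variables (eps : R) (Gamma : R * R -> 'rV[R]_4) (U : set (R * R)).
Hypotheses (eps0 : 0 < eps) (oU : open U).
Hypothesis segU : `]- eps, eps[ `*` `[a, b] `<=` U.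
Hypothesis Gamma_smooth : forall n, diff_upto U n Gamma.
Hypothesis GammaP : forall s t : R, s \in `]- eps, eps[ -> t \in `[a, b] ->
  hyperbolic_plane r P3 (Gamma (s, t)).
Hypothesis Gamma0 : forall t, t \in `[a, b] -> Gamma (0, t) = gamma t.
Hypothesis Gamma_ends : forall s, s \in `]- eps, eps[ ->
  Gamma (s, a) = gamma a /\ Gamma (s, b) = gamma b.

Let gamma' := 'D_1 gamma.
Let Gs := 'D_((1, 0) : R * R) Gamma.
Let Gt := 'D_((0, 1) : R * R) Gamma.
(* The integrand |h| |d_t Gamma| is the square root of [weight], which avoids
   the sign of the height h. *)
Let weight p := lorentz (Gamma p) nu ^+ 2 * lorentz (Gt p) (Gt p).
Let L p := Num.sqrt (weight p).
(** The closed form of the [s]-derivative of [L]; its continuity where [weight] is positive provides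
    the bound for differentiating under the integral. *)
Let Ls p := (2 * lorentz (Gamma p) nu * lorentz (Gs p) nu * lorentz (Gt p) (Gt p)
  + lorentz (Gamma p) nu ^+ 2 *
    (2 * lorentz ('D_((1, 0) : R * R) Gt p) (Gt p))) / (2 * L p).

Let s0 : (0 : R) \in `]- eps, eps[.
Proof. by rewrite in_itv/= oppr_lt0 eps0. Qed.

Let U0 t : t \in `[a, b] -> U (0, t).
Proof. by move=> tab; apply: segU. Qed.

Let gamma'_smooth := smooth_derive gamma_smooth 1.
Let Gt_smooth := smooth_derive Gamma_smooth (0, 1).
Let Gs_smooth := smooth_derive Gamma_smooth (1, 0).
Let Gts_smooth := smooth_derive Gt_smooth (1, 0).

Let gamma_der t : t \in `[a, b] -> is_derive t 1 gamma (gamma' t).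
Proof. by move=> tab; exact/(smooth_is_derive gamma_smooth)/abA. Qed.

(** [Gamma (0, t)] and [gamma t] agree for [t] in [[a, b]] only, so the endpoints need one-sided
    quotients. *)
Let Gt0 t : t \in `[a, b] -> Gt (0, t) = gamma' t.
Proof.
move=> tab; rewrite /Gt partial_sndE; apply: (eq_derive_segment ab tab) => //.
- by case: (smooth_is_derive_snd Gamma_smooth (U0 tab)).
- by case: (gamma_der tab).
Qed.

Let gamma'_pos t : t \in `[a, b] -> 0 < lorentz (gamma' t) (gamma' t).
Proof.
move=> tab; have [_ [gg _]] := gammaP tab.
apply: (@orth_timelike_spacelike _ (gamma t)); last exact: gamma'0.
  by rewrite gg oppr_lt0 exprn_gt0.
have [D _] := gamma_der tab.
by case: (curve_orth ab tab D gammaP Pe).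
Qed.

Let weight0 t : t \in `[a, b] -> 0 < weight (0, t).
Proof.
move=> tab; rewrite /weight Gamma0// Gt0// mulr_gt0 ?gamma'_pos//.
by rewrite exprn_even_gt0 ?height0.
Qed.

Let weight_cont p : U p -> {for p, continuous weight}.
Proof.
move=> Up.
have c1 : {for p, continuous (fun p => lorentz (Gamma p) nu)}.
  apply: continuous_lorentz; last exact: cst_continuous.
  exact: (smooth_continuous Gamma_smooth).
have c2 : {for p, continuous (fun p => lorentz (Gt p) (Gt p))}.
  by apply: continuous_lorentz; exact: (smooth_continuous Gt_smooth).
by apply: cvgM => //; apply: cvgM.
Qed.

Let L_cont p : U p -> {for p, continuous L}.
Proof.
move=> Up; apply: (@cvg_comp _ _ _ weight Num.sqrt _ _ _ (weight_cont Up)).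
exact: sqrt_continuous.
Qed.

(** A varied curve may be singular or meet [P2], where the square root [L] need not be
    differentiable; near [s = 0] this is excluded. *)
Let near_good t : t \in `[a, b] -> \forall p \near (0, t), U p /\ 0 < weight p.
Proof.
move=> tab; apply: filterI.
  by apply: open_nbhs_nbhs; split => //; exact: U0.
exact: (cvgr_gt _ (weight_cont (U0 tab)) _ (weight0 tab)).
Qed.

Let L_derive s t : U (s, t) -> 0 < weight (s, t) ->
  is_derive s 1 (fun s => L (s, t)) (Ls (s, t)).
Proof.
move=> Up w0.
apply: (@is_derive_sqrt_weight _ (fun s => lorentz (Gamma (s, t)) nu)
  (fun s => lorentz (Gt (s, t)) (Gt (s, t))) s _ _ _ _ w0).
- exact: (is_derive_linear (@continuous_lorentzr R nu)
    (smooth_is_derive_fst Gamma_smooth Up)).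
- exact: is_derive_lorentz_sqr (smooth_is_derive_fst Gt_smooth Up).
Qed.

Let L_derivable p : U p -> 0 < weight p ->
  derivable L p (1, 0) /\ 'D_((1, 0) : R * R) L p = Ls p.
Proof.
case: p => s t Up w0; have [D DE] := L_derive Up w0.
by rewrite derivable_partial_fst partial_fstE.
Qed.

Let Ls_cont p : U p -> 0 < weight p -> {for p, continuous Ls}.
Proof.
move=> Up w0.
have cG := smooth_continuous Gamma_smooth Up.
have cGs := smooth_continuous Gs_smooth Up.
have cGt := smooth_continuous Gt_smooth Up.
have cGts := smooth_continuous Gts_smooth Up.
have cnu : {for p, continuous (fun _ : R * R => nu)} by exact: cst_continuous.
have c2 : (fun _ : R * R => 2 : R) @ p --> (2 : R) by exact: cvg_cst.
have c1 := continuous_lorentz cG cnu.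
have c3 := continuous_lorentz cGs cnu.
have c4 := continuous_lorentz cGt cGt.
have c5 := continuous_lorentz cGts cGt.
have n0 : 2 * L p != 0 by rewrite mulf_neq0 ?pnatr_eq0// gt_eqF// sqrtr_gt0.
have cL : L @ p --> L p by exact: L_cont.
have cd : (fun p => 2 * L p) @ p --> 2 * L p by exact: cvgM.
exact: (cvgM (cvgD (cvgM (cvgM (cvgM c2 c1) c3) c4)
  (cvgM (cvgM c1 c1) (cvgM c2 c5))) (cvgV n0 cd)).
Qed.

Let DL_cont t : t \in `[a, b] ->
  {for (0, t), continuous ('D_((1, 0) : R * R) L)}.
Proof.
move=> tab; apply: (@near_eq_continuous _ _ Ls).
  apply: filterS (near_good tab) => p [Up w0].
  by have [_ ->] := L_derivable Up w0.
exact: Ls_cont (U0 tab) (weight0 tab).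
Qed.

Let W t := Gs (0, t).
Let h t := lorentz (gamma t) nu.
Let E t := lorentz (gamma' t) (gamma' t).
(* The boundary term <W, |h| gamma' / |gamma'|> of the first variation. *)
Let Phi t := h t ^+ 2 * lorentz (W t) (gamma' t) / Num.sqrt (h t ^+ 2 * E t).

Let hE0 t : t \in `[a, b] -> 0 < h t ^+ 2 * E t.
Proof.
by move=> tab; have := weight0 tab; rewrite /weight (Gamma0 tab) (Gt0 tab).
Qed.

Let Phi' t (S := Num.sqrt (h t ^+ 2 * E t)) :=
  (2 * h t * lorentz (gamma' t) nu * lorentz (W t) (gamma' t)
   + h t ^+ 2 * (lorentz ('D_((0, 1) : R * R) Gs (0, t)) (gamma' t)
                 + lorentz (W t) ('D_1 gamma' t))) * S^-1
  - h t ^+ 2 * lorentz (W t) (gamma' t) *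
    ((2 * h t * lorentz (gamma' t) nu * E t
      + h t ^+ 2 * (2 * lorentz ('D_1 gamma' t) (gamma' t))) / (2 * S)) / S ^+ 2.

Let Phi_derive t : t \in `[a, b] -> is_derive t 1 Phi (Phi' t).
Proof.
move=> tab.
have dg := gamma_der tab.
have dg' : is_derive t 1 gamma' ('D_1 gamma' t).
  by exact/(smooth_is_derive gamma'_smooth)/abA.
have dW : is_derive t 1 W ('D_((0, 1) : R * R) Gs (0, t)).
  exact: smooth_is_derive_snd Gs_smooth (U0 tab).
have dh : is_derive t 1 h (lorentz (gamma' t) nu).
  exact: (is_derive_linear (@continuous_lorentzr R nu) dg).
have dE := is_derive_lorentz_sqr dg'.
exact: is_derive_momentum dh (is_derive_lorentz dW dg') dE (hE0 tab).
Qed.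

Let frame t : t \in `]a, b[ -> exists n m,
  [/\ lorentz n (gamma t) = 0, lorentz n (gamma' t) = 0, lorentz n e = 0,
     lorentz n n = 1 &
     W t = (lorentz (W t) (gamma' t) / E t) *: gamma' t + m *: n].
Proof.
move=> /subset_itv_oo_cc tab.
have [gg' ge'] :=
  curve_orth ab tab (ex_derive (is_derive := gamma_der tab)) gammaP Pe.
have [g3 [gg _]] := gammaP tab.
have gl0 : lorentz (gamma t) (gamma t) < 0 by rewrite gg oppr_lt0 exprn_gt0.
have [u [u0 ug ug' ue]] := exists_orth3 (gamma t) (gamma' t) e.
have uu := orth_timelike_spacelike gl0 ug u0.
pose k := (Num.sqrt (lorentz u u))^-1; pose n := k *: u.
have nn : lorentz n n = 1.
  rewrite /n lorentzZl lorentzZr mulrA -expr2 /k exprVn sqr_sqrtr ?ltW//.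
  by rewrite mulVf// gt_eqF.
have no v : lorentz u v = 0 -> lorentz n v = 0.
  by rewrite /n lorentzZl => ->; rewrite mulr0.
have ng := no _ ug; have ng' := no _ ug'; have ne := no _ ue.
exists n, (lorentz (W t) n); split=> //.
(* [curve_orth] is now applied in [s], on a closed segment around 0 inside the variation range: it
   makes [W t] orthogonal to [gamma t] and [e]. *)
have e2 : - (eps / 2) < eps / 2 by rewrite gtrN// divr_gt0.
have z2 : 0 \in `[- (eps / 2), eps / 2].
  by rewrite in_itv/=; apply/andP; split; lra.
have WP u' : u' \in `[- (eps / 2), eps / 2] ->
    hyperbolic_plane r P3 (Gamma (u', t)).
  by move=> ue2; apply: GammaP => //; move: ue2; rewrite !in_itv/=; lra.
have [Ds DsE] := smooth_is_derive_fst Gamma_smooth (U0 tab).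
have [Wg We] := curve_orth e2 z2 Ds WP Pe.
rewrite DsE Gamma0// in Wg We.
have sym (u' v : 'rV[R]_4) : lorentz u' v = 0 -> lorentz v u' = 0.
  by rewrite lorentzC.
exact: (frame_decomposition gl0 (gamma'_pos tab) ee nn (sym _ _ gg') (Pe g3)
  (sym _ _ ng) ge' (sym _ _ ng') (sym _ _ ne) Wg We).
Qed.

Let Phi'E t : t \in `]a, b[ -> Phi' t = 'D_((1, 0) : R * R) L (0, t).
Proof.
move=> tab; have tab' := subset_itv_oo_cc tab.
have [_ ->] := L_derivable (U0 tab') (weight0 tab').
have [n [m [ng ng' ne nn WE]]] := frame tab.
have ode := profile_equation tab ng ng' ne nn.
have Wnu : lorentz (W t) nu =
    (lorentz (W t) (gamma' t) / E t) * lorentz (gamma' t) nu + m * lorentz nu n.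
  rewrite {1}WE lorentzDl 2!lorentzZl (lorentzC n); reflexivity.
have Wg2 : lorentz (W t) ('D_1 gamma' t) =
    (lorentz (W t) (gamma' t) / E t) * lorentz ('D_1 gamma' t) (gamma' t)
    + m * lorentz ('D_1 gamma' t) n.
  rewrite {1}WE lorentzDl 2!lorentzZl (lorentzC n) (lorentzC (gamma' t)).
  reflexivity.
(* [Phi'] contains the mixed derivative of [Gamma] taken first in [s], [Ls] the one taken first in
   [t]. *)
have sch := schwarz_lorentz (gamma' t) oU (U0 tab') Gamma_smooth.
have E0 := gamma'_pos tab'.
have S2 : Num.sqrt (h t ^+ 2 * E t) ^+ 2 = h t ^+ 2 * E t.
  exact: sqr_sqrtr (ltW (hE0 tab')).
have S0 : Num.sqrt (h t ^+ 2 * E t) != 0.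
  by apply: lt0r_neq0; rewrite sqrtr_gt0; exact: hE0.
have -> : Ls (0, t) = (2 * h t * lorentz (W t) nu * E t + h t ^+ 2 *
    (2 * lorentz ('D_((1, 0) : R * R) Gt (0, t)) (gamma' t))) /
    (2 * Num.sqrt (h t ^+ 2 * E t)).
  by rewrite /Ls /L /weight (Gamma0 tab') (Gt0 tab').
exact: momentum_identity ode (lt0r_neq0 E0) S0 S2 Wnu Wg2 (esym sch).
Qed.

Let Phi_ends : Phi a = 0 /\ Phi b = 0.
Proof.
have aab : a \in `[a, b] by rewrite in_itv/= lexx ltW.
have bab : b \in `[a, b] by rewrite in_itv/= lexx ltW.
have W0 t c : t \in `[a, b] ->
    (forall s, s \in `]- eps, eps[ -> Gamma (s, t) = c) ->
    W t = 0.
  move=> tab Gc; rewrite /W /Gs partial_fstE.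
  have near0 : {near (0 : R), (fun s => Gamma (s, t)) =1 cst c}.
    have : \forall s \near (0 : R), s \in `]- eps, eps[ by exact: near_in_itvoo.
    by apply: filterS => s /Gc.
  by rewrite (near_eq_derive _ near0) derive_cst.
have Wa : W a = 0 by apply: (W0 _ (gamma a)) => // s /Gamma_ends[].
have Wb : W b = 0 by apply: (W0 _ (gamma b)) => // s /Gamma_ends[].
by split; rewrite /Phi ?Wa ?Wb (lorentz0l (gamma' _)) mulr0 mul0r.
Qed.

Lemma first_variation_zero :
  is_derive (0 : R) (1 : R)
    (fun s => catenary_functional nu a b (fun t => Gamma (s, t))) 0.
Proof.
have -> : (fun s => catenary_functional nu a b (fun t => Gamma (s, t))) =
    (fun s => \int[lebesgue_measure]_(t in `[a, b]) L (s, t)).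
  (* The equality must hold for every real [s], also outside the variation range, where [Gt] may be
     timelike; splitting the root requires only that [h^2] be nonnegative. *)
  apply/funext => s; apply: eq_Rintegral => t _.
  rewrite /L /weight /extrinsic_dist /Gt partial_sndE.
  by rewrite sqrtrM ?sqr_ge0// sqrtr_sqr.
apply: is_derive_eq; first apply: derive_integral_parameter.
- move=> t tab; apply: filterS (near_good tab) => p [Up w0].
  by split; [case: (L_derivable Up w0)|exact: L_cont].
- exact: DL_cont.
have cf : {within `[a, b], continuous (fun t => 'D_((1, 0) : R * R) L (0, t))}.
  apply/continuous_in_subspaceT => t; rewrite inE/= => tab.
  exact: (@cvg_comp _ _ _ (fun t => (0, t)) ('D_((1, 0) : R * R) L) _ _ _
    (cvg_pair (cvg_cst _) cvg_id) (DL_cont tab)).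
have PhiLR : derivable_oo_LRcontinuous Phi a b.
  have Phic t : t \in `[a, b] -> Phi @ t --> Phi t.
    move=> tab; apply/differentiable_continuous/derivable1_diffP.
    by case: (Phi_derive tab).
  split.
  - by move=> t /subset_itv_oo_cc tab; case: (Phi_derive tab).
  - by apply: cvg_at_right_filter; apply: Phic; rewrite in_itv/= lexx ltW.
  - by apply: cvg_at_left_filter; apply: Phic; rewrite in_itv/= lexx ltW.
have Phid :
    {in `]a, b[, derive1 Phi =1 (fun t => 'D_((1, 0) : R * R) L (0, t))}.
  move=> t tab; rewrite derive1E -Phi'E//.
  by case: (Phi_derive (subset_itv_oo_cc tab)).
rewrite /Rintegral (continuous_FTC2 ab cf PhiLR Phid).
by have [-> ->] := Phi_ends; rewrite sube0.
Qed.

End FirstVariation.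

Theorem theorem1 (R : realType) (r : R) (P2 P3 : {vspace 'rV[R]_4})
    (I : set R) (gamma : R -> 'rV[R]_4)
    (hr : 0 < r)
    (hP2 : \dim P2 = 2%N) (hP3 : \dim P3 = 3%N) (hP23 : (P2 <= P3)%VS)
    (hP3H : hyperbolic_plane r P3 !=set0)
    (hI : is_interval I)
    (hgamma : regular_curve r P3 I gamma)
    (havoid : avoids I gamma P2)
    (hmin : minimal_surface r (surface_of_revolution r P2 I gamma)) :
  extrinsic_catenary r P2 P3 I gamma /\
  [/\ surface_of_revolution_type Elliptic P2 ->
        extrinsic_catenary_of_type Elliptic r P2 P3 I gamma,
      surface_of_revolution_type Hyperbolic P2 ->
        extrinsic_catenary_of_type Hyperbolic r P2 P3 I gamma &
      surface_of_revolution_type Parabolic P2 ->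
        extrinsic_catenary_of_type Parabolic r P2 P3 I gamma].
Proof.
(* The argument is uniform in the causal type; the three cases merely carry the type of [P2]
   along. *)
suff cat : extrinsic_catenary r P2 P3 I gamma by split=> //; split.
split=> // nu nuP a b ab abI eps Gamma [eps0 [U [oU segU] US] GP G0 Gends].
have [[A [oA IA] AS] gP g'0] := hgamma.
have [q [q3 [qq _]]] := hP3H.
have r20 : - r ^+ 2 < 0 by rewrite oppr_lt0 exprn_gt0.
have [e ee Pe] : exists2 e : 'rV[R]_4, lorentz e e = 1 &
    forall p, p \in P3 -> lorentz p e = 0.
  by apply: exists_unit_normal hP3 q3 _; rewrite qq.
have abA : `[a, b] `<=` A by exact: subset_trans IA.
have height0 t : t \in `[a, b] -> lorentz (gamma t) nu != 0.
  move=> /abI It; have [g3 [gg _]] := gP t It.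
  by apply: (conormal_neq0 hP2 hP3 hP23 g3 (havoid t It) _ nuP); rewrite gg.
have oc t : t \in `]a, b[ -> t \in `[a, b] by exact: subset_itv_oo_cc.
apply: (@first_variation_zero R r P3 a b gamma nu e A hr ab abA _ _ _ ee Pe
  height0 _ eps Gamma U eps0 oU segU) => //.
- by move=> n vs _; exact: AS.
- by move=> t /abI; exact: gP.
- by move=> t /abI; exact: g'0.
- move=> n t tab ng ng' ne nn.
  apply: (@minimal_profile_equation R r P2 P3 a b gamma nu e A hr hP23 _ AS
    _ _ nuP ee Pe _ I n t hmin) => //.
  + by move=> u /oc; exact: abA.
  + by move=> u /oc/abI; exact: gP.
  + by move=> u /oc/abI; exact: g'0.
  + by move=> u /oc; exact: height0.
  + by move=> u /oc; exact: abI.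
- by move=> n vs _; exact: US.
Qed.
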